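(* Let $\Gamma$ be a metric graph, let $e$ be an edge segment of $\Gamma$ with endpoints $\partial e=\{e^-,e^+\}$, and let $x,y\in\Gamma$. Then $$ r(x,y;\Gamma/e)=r(x,y;\Gamma)-\frac{\xi(x,y,e^-,e^+;\Gamma)^2}{r(e^-,e^+;\Gamma)}\,. $$ In particular, $r(x,y;\Gamma/e)\le r(x,y;\Gamma)$.
   Context: A metric graph $\Gamma$ is a compact connected metric space, not reduced to a point, such that every point has a neighborhood isometric to a star-shaped set, endowed with the path metric. A branch point is a point of valency different from $2$. A vertex set of $\Gamma$ is a finite set $V\subset\Gamma$ containing all branch points such that the closure of each connected component of $\Gamma\setminus V$ is isometric with a closed interval. An edge segment $e$ of $\Gamma$ is the closure of a connected component of $\Gamma\setminus V$ for some vertex set $V$; its two boundary points are denoted $\partial e=\{e^-,e^+\}\subset V$. $\Gamma/e$ is the quotient metric graph obtained by collapsing $e$ to a single point (all other lengths being kept). Points of $\Gamma$ are regarded on $\Gamma/e$ via their images under the quotient map. If $\Gamma/e$ is a single point, the definitions below still apply and give identically zero functions. $\mathrm{PL}(\Gamma)$ is the real vector space of continuous piecewise affine real-valued functions on $\Gamma$ with finitely many changes of slope. For $\phi\in \mathrm{PL}(\Gamma)$, $\Delta(\phi)=\sum_{p\in\Gamma}\sigma_p(\phi)\delta_p$, where $\delta_p$ is the Dirac measure at $p$ and $\sigma_p(\phi)$ is the sum of the incoming slopes of $\phi$ at $p$ over all tangent directions (i.e. minus the sum of the outgoing directional derivatives). For $y,z\in\Gamma$, $j_z(\cdot,y;\Gamma)$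 is the unique function in $\mathrm{PL}(\Gamma)$ with $\Delta(j_z(\cdot,y;\Gamma))=\delta_y-\delta_z$ and $j_z(z,y;\Gamma)=0$. The effective resistance is $r(x,y;\Gamma)=j_y(x,x;\Gamma)=j_x(y,y;\Gamma)$. The cross ratio is $\xi(x,y,z,w;\Gamma)=j_q(x,z;\Gamma)+j_q(y,w;\Gamma)-j_q(x,w;\Gamma)-j_q(y,z;\Gamma)$ for any $q\in\Gamma$; it is independent of $q$.
   Formalization: The identity is stated only for x, y not in the interior of e (e minus e^-, e^+): it fails for interior points unless x=y, e.g. Γ=e=[0,1], x=1/2, y=0 gives 0 on the left and 1/4 on the right. The inequality is stated for all x, y. *)

(* Defs.v *)
From HB Require Import structures.
From mathcomp Require Import all_boot all_order all_algebra.
From mathcomp Require Import all_classical all_reals all_analysis.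
Set Implicit Arguments.
Unset Strict Implicit.
Unset Printing Implicit Defensive.
Import Order.TTheory GRing.Theory Num.Theory.
Import numFieldTopology.Exports numFieldNormedType.Exports.
Local Open Scope classical_set_scope.
Local Open Scope ring_scope.
Local Open Scope quotient_scope.

Section PathMetric.
Context {R : realType} {T : metricType R}.

(* Length of a path parametrized by [0, 1]: the supremum, over the partitions
   0 < s_1 < ... < s_n = 1, of the lengths of the inscribed chains. *)
Definition path_length (g : R -> T) : \bar R :=
  ereal_sup [set (\sum_(0 <= i < size s)
    mdist (g (nth 1 (0 :: s) i)) (g (nth 1 (0 :: s) i.+1)))%:E
    | s in [set s | itv_partition 0 1 s]].

Definition path_between (A : set T) (x y : T) (g : R -> T) : Prop :=
  [/\ {within `[0, 1], continuous g}, g 0 = x, g 1 = y & g @` `[0, 1] `<=` A].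

(* The path metric of A; it is +oo between points not joined by a rectifiable
   path inside A. *)
Definition path_dist (A : set T) (x y : T) : \bar R :=
  ereal_inf [set path_length g | g in path_between A x y].

(* g is an isometry from [0, l] onto A, where A carries its path metric and not
   the restriction of the metric of T: with the latter, the longer of two
   parallel edges would not be isometric with an interval. *)
Definition interval_isometry (A : set T) (l : R) (g : R -> T) : Prop :=
  [/\ 0 < l, g @` `[0, l] = A &
      forall s t, `[0, l]%classic s -> `[0, l]%classic t ->
        path_dist A (g s) (g t) = `|s - t|%:E].

End PathMetric.

Section MetricGraph.
Context {R : realType} {T : metricType R}.

(* The star-shaped set with n branches of length r: (k, t) is the point at
   distance t from the center on the k-th branch, so that all the (k, 0) stand
   for the center. *)
Definition star (n : nat) (r : R) : set ('I_n * R) :=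
  [set u | 0 <= u.2 < r].
Arguments star : clear implicits.

Definition star_dist (n : nat) (u v : 'I_n * R) : R :=
  if u.1 == v.1 then `|u.2 - v.2| else u.2 + v.2.

Definition locally_star_shaped (p : T) : Prop :=
  exists n r (phi : 'I_n * R -> T),
    [/\ (0 < n)%N, 0 < r, forall k, phi (k, 0) = p, nbhs p (phi @` star n r) &
        forall u v, star n r u -> star n r v ->
          mdist (phi u) (phi v) = star_dist u v].

Definition metric_graph : Prop :=
  [/\ compact [set: T], connected [set: T], exists x y : T, x <> y,
      forall p : T, locally_star_shaped p &
      forall x y : T, (mdist x y)%:E = path_dist setT x y].

(* A tangent direction at p is the germ at 0 of a unit speed geodesic issuing
   from p. *)
Definition geodesic_from (p : T) (g : R -> T) : Prop :=
  g 0 = p /\ exists2 eps, 0 < eps &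
    forall s t, 0 <= s < eps -> 0 <= t < eps -> mdist (g s) (g t) = `|s - t|.

Definition germ (g : R -> T) : set (R -> T) :=
  [set h | exists2 eps, 0 < eps & forall t, 0 <= t < eps -> h t = g t].

Definition tangents (p : T) : set (set (R -> T)) :=
  [set germ g | g in geodesic_from p].

Definition branch_point (p : T) : Prop := ~ (tangents p #= `I_2)%card.

Definition component_of (A C : set T) : Prop :=
  exists2 x, A x & C = connected_component A x.

Definition vertex_set (V : set T) : Prop :=
  [/\ finite_set V, branch_point `<=` V &
      forall C, component_of (~` V) C ->
        exists l g, interval_isometry (closure C) l g].

Definition PL (f : T -> R) : Prop :=
  continuous f /\ exists2 V, vertex_set V &
    forall C, component_of (~` V) C ->
    forall l g, interval_isometry (closure C) l g ->
      exists a b, forall t, `[0, l]%classic t -> f (g t) = a + b * t.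

Definition outgoing_slope (f : T -> R) (v : set (R -> T)) : R :=
  get [set s | forall g, v g ->
    (f (g t) - f (g 0)) / t @[t --> 0^'+] --> s].

Definition sigma (f : T -> R) (p : T) : R :=
  - \sum_(v \in tangents p) outgoing_slope f v.

(* A discrete signed measure is given by its values on all the subsets of T;
   \1_A p is the mass that the Dirac measure at p gives to A. *)
Definition Laplacian (f : T -> R) : set T -> R :=
  fun A => \sum_(p \in [set: T]) sigma f p * \1_A p.

(* jfun z x y is j_z(x, y). *)
Definition jfun (z x y : T) : R :=
  xget (fun=> 0) [set f : T -> R | [/\ PL f,
    Laplacian f = (fun A => \1_A y - \1_A z) & f z = 0]] x.

Definition resistance (x y : T) : R := jfun y x x.

(* The cross ratio computed with the base point q. *)
Definition cross_ratio (q x y z w : T) : R :=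
  jfun q x z + jfun q y w - jfun q x w - jfun q y z.

End MetricGraph.

Arguments metric_graph {R} T.

Record edge_segment (R : realType) (T : metricType R) := EdgeSegment {
  edge_set :> set T;
  edge_minus : T;
  edge_plus : T;
  edge_setP : exists V C, [/\ vertex_set V, component_of (~` V) C,
    edge_set = closure C &
    exists l g, [/\ interval_isometry edge_set l g,
      g 0 = edge_minus & g l = edge_plus]] }.

Arguments edge_minus {R T}.
Arguments edge_plus {R T}.

(* The interior of the interval e; it may differ from the topological interior
   of e in T, when e contains an end of T. For x in it, the value
   r(x, y) - xi(x, y, e^-, e^+)^2 / r(e^-, e^+) is the resistance after gluing
   e^- to e^+, with e becoming a loop, and not after collapsing e: on e = [0, 1],
   for x = 1/2 and y = 0, it is 1/4 and not 0. *)
Definition edge_interior (R : realType) (T : metricType R)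
    (e : edge_segment T) : set T := e `\` [set edge_minus e; edge_plus e].

Section Collapse.
Context {R : realType} {T : metricType R} (e : edge_segment T).

Definition collapse_rel (x y : T) : bool :=
  (x == y) || `[< edge_set e x >] && `[< edge_set e y >].

Lemma collapse_rel_equiv : equiv_class_of collapse_rel.
Proof.
rewrite /collapse_rel; split=> [x|x y|y x z] /=; first by rewrite eqxx.
- by rewrite eq_sym andbC.
- case/orP=> [/eqP->//|/andP[ex ey]]; case/orP=> [/eqP<-|/andP[_ ez]].
    by rewrite ex ey orbT.
  by rewrite ex ez orbT.
Qed.

Definition collapse_equiv := EquivRelPack collapse_rel_equiv.

Definition collapse := {eq_quot collapse_equiv}.

HB.instance Definition _ := Choice.on collapse.
HB.instance Definition _ := EqQuotient.on collapse.

Definition collapse_map (x : T) : collapse := \pi_collapse x.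

Definition dist_to_edge (x : T) : R := inf [set mdist x a | a in e].

(* The quotient metric: the infimum over the chains in which jumps inside e are
   free, which reduces to the chains with at most one jump. *)
Definition collapse_dist (x y : T) : R :=
  Num.min (mdist x y) (dist_to_edge x + dist_to_edge y).

Lemma edge_nonempty : edge_set e (edge_minus e).
Proof.
have [V [C [_ _ _ [l [g [[l0 <- _] <- _]]]]]] := edge_setP e.
by exists 0 => //=; rewrite in_itv/= lexx ltW.
Qed.

Lemma edge_closed : closed (edge_set e).
Proof. by have [V [C [_ _ -> _]]] := edge_setP e; exact: closed_closure. Qed.

Lemma dist_to_edge_lb (x : T) : lbound [set mdist x a | a in e] 0.
Proof. by move=> _ [a _ <-]; exact: mdist_ge0. Qed.

Lemma dist_to_edge_ge0 x : 0 <= dist_to_edge x.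
Proof.
apply: lb_le_inf; last exact: dist_to_edge_lb.
by exists (mdist x (edge_minus e)); exists (edge_minus e) => //; exact: edge_nonempty.
Qed.

Lemma dist_to_edge_le x a : edge_set e a -> dist_to_edge x <= mdist x a.
Proof.
by move=> ea; apply: ge_inf; [exists 0; exact: dist_to_edge_lb|exists a].
Qed.

Lemma dist_to_edge_triangle x y : dist_to_edge x <= mdist x y + dist_to_edge y.
Proof.
rewrite -lerBlDl; apply: lb_le_inf.
  by exists (mdist y (edge_minus e)); exists (edge_minus e) => //; exact: edge_nonempty.
move=> _ [a ea <-]; rewrite lerBlDl.
exact: le_trans (dist_to_edge_le x ea) (metric_triangle _ _ _).
Qed.

Lemma dist_to_edge_eq0 x : (dist_to_edge x = 0) <-> edge_set e x.
Proof.
split=> [x0|ex]; last first.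
  apply/eqP; rewrite eq_le dist_to_edge_ge0 andbT -(mdistxx x).
  exact: dist_to_edge_le.
apply: edge_closed => B /nbhs_ballP[r r0 xB].
have infe : has_inf [set mdist x a | a in e].
  split; last by exists 0; exact: dist_to_edge_lb.
  by exists (mdist x (edge_minus e)); exists (edge_minus e) => //; exact: edge_nonempty.
have [_ [a ea <-] ar] := inf_adherent r0 infe.
exists a; split=> //; apply: xB; rewrite ballEmdist /=.
by move: ar; rewrite -/(dist_to_edge x) x0 add0r.
Qed.

Lemma collapse_distxx x : collapse_dist x x = 0.
Proof.
rewrite /collapse_dist mdistxx; apply/min_idPl.
by rewrite addr_ge0// dist_to_edge_ge0.
Qed.

Lemma collapse_dist_sym x y : collapse_dist x y = collapse_dist y x.
Proof. by rewrite /collapse_dist metric_sym addrC. Qed.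

Lemma collapse_dist_triangle y x z :
  collapse_dist x z <= collapse_dist x y + collapse_dist y z.
Proof.
have [[Dx Dy] Dz] := (dist_to_edge_ge0 x, dist_to_edge_ge0 y, dist_to_edge_ge0 z).
have xyz := metric_triangle x y z.
have xy := dist_to_edge_triangle x y.
have zy := dist_to_edge_triangle z y; rewrite (metric_sym z y) in zy.
rewrite /collapse_dist ge_min.
case: (leP (mdist x y)) => _; case: (leP (mdist y z)) => _.
- by rewrite xyz.
- by apply/orP; right; rewrite addrA lerD2r.
- by apply/orP; right; rewrite -addrA lerD2l addrC.
- by apply/orP; right; rewrite -addrA lerD2l addrA lerDr addr_ge0.
Qed.

Lemma collapse_dist_eq0 x y : collapse_dist x y = 0 -> collapse_rel x y.
Proof.
rewrite /collapse_dist /collapse_rel; case: leP => _.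
  by move/mdist_positivity=> ->; rewrite eqxx.
move/eqP; rewrite paddr_eq0 ?dist_to_edge_ge0// => /andP[/eqP x0 /eqP y0].
by apply/orP; right; apply/andP; split; apply/asboolP/dist_to_edge_eq0.
Qed.

Lemma collapse_rel_dist x x' y : collapse_rel x x' ->
  collapse_dist x y = collapse_dist x' y.
Proof.
case/orP=> [/eqP->//|/andP[/asboolP ex /asboolP ex']].
rewrite /collapse_dist (dist_to_edge_eq0 x).2// (dist_to_edge_eq0 x').2// add0r.
have le a : edge_set e a -> dist_to_edge y <= mdist a y.
  by move=> ea; rewrite metric_sym; exact: dist_to_edge_le.
by rewrite !(min_idPr (le _ _)).
Qed.

Definition quot_dist (u v : collapse) : R := collapse_dist (repr u) (repr v).

Lemma quot_distE x y :
  quot_dist (collapse_map x) (collapse_map y) = collapse_dist x y.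
Proof.
have eqr z : collapse_rel (repr (collapse_map z)) z.
  by apply/(eqmodP collapse_equiv); rewrite /collapse_map reprK.
rewrite /quot_dist (collapse_rel_dist _ (eqr x)) collapse_dist_sym.
by rewrite (collapse_rel_dist _ (eqr y)) collapse_dist_sym.
Qed.

Lemma quot_distxx u : quot_dist u u = 0.
Proof. exact: collapse_distxx. Qed.

Lemma quot_dist_positivity u v : quot_dist u v = 0 -> u = v.
Proof.
by move=> /collapse_dist_eq0 uv; rewrite -[u]reprK -[v]reprK; exact/(eqmodP collapse_equiv).
Qed.

Lemma quot_dist_sym u v : quot_dist u v = quot_dist v u.
Proof. exact: collapse_dist_sym. Qed.

Lemma quot_dist_triangle v u w : quot_dist u w <= quot_dist u v + quot_dist v w.
Proof. exact: collapse_dist_triangle. Qed.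

HB.instance Definition _ := isMetric.Build R collapse
  quot_distxx quot_dist_positivity quot_dist_sym quot_dist_triangle.

End Collapse.

(* Main.v *)
(* A function on a graph is PL if and only if it is affine along every germ of
   geodesic; this local description makes no reference to a vertex set, and such
   functions satisfy the maximum principle. Existence of j_z(., y) and reciprocity
   follow by duality: a linear functional vanishing on all Laplacians satisfies the
   mean value property on small cones, so it is constant on the Dirac masses.

   For x, y outside the interior of e, the function
     F = j_y(., x) - c j_{e+}(., e-),  c = (j_y(e-, x) - j_y(e+, x)) / r(e-, e+),
   takes the same value at e- and e+ and is harmonic inside e, hence is constant on e
   and descends to the collapsed graph, where its Laplacian is that of j_y(., x).
   Then r(x, y; Gamma/e) = F x - F y, and the formula is reciprocity. *)
From HB Require Import structures.
Require Import Defs.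
From mathcomp Require Import all_boot all_order all_algebra.
From mathcomp Require Import all_classical all_reals all_analysis.
From mathcomp Require Import ring lra.
Import Order.TTheory GRing.Theory Num.Theory.
Import numFieldTopology.Exports numFieldNormedType.Exports.
Local Open Scope classical_set_scope.
Local Open Scope ring_scope.

Set Implicit Arguments.
Unset Strict Implicit.
Unset Printing Implicit Defensive.

(** * Star charts *)

(** A metric graph comes without a combinatorial model: no vertex set adapted to a given function is
    provided, and the Laplacian is not a matrix. The theory therefore rests on three properties
    ([network]): star charts, compactness, connectedness. They pass to the quotient by direct
    computation with its metric, and they make sense for a single point, whose chart has no branch.
    Vertex sets return only where [PL] is matched with its germ description. Since [jfun] selects a
    function inside [PL], its values are known only once both existence and uniqueness in [PL] are
    established. An edge is isometric with an interval for its own path metric, so its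
    parametrization is merely 1-Lipschitz in the ambient metric; locating the edge in a star chart
    at one of its ends takes a connectedness argument. When x lies in e and y does not, the
    inequality comes from convexity: the resistance in the collapsed graph is a convex combination
    of j_y(e-, x) and j_y(e+, x), both at most r(x, y). *)

Section Charts.
Context {R : realType} {T : metricType R}.
Implicit Types (p x : T) (f : T -> R) (r e s t : R).

(* K may be empty: this is the chart of a graph collapsed to a point. *)
Definition star_chart (K : finType) p (r : R) (phi : K -> R -> T) : Prop :=
  [/\ 0 < r, forall k, phi k 0 = p,
      forall x, mdist p x < r -> x = p \/ exists k t, 0 < t < r /\ x = phi k t,
      forall k s t, 0 <= s < r -> 0 <= t < r ->
        mdist (phi k s) (phi k t) = `|s - t| &
      forall j k s t, j != k -> 0 <= s < r -> 0 <= t < r ->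
        mdist (phi j s) (phi k t) = s + t].

Definition germ_affine f := forall p g, geodesic_from p g ->
  exists b : R, exists2 eps : R, 0 < eps &
    forall t, 0 <= t < eps -> f (g t) = f p + b * t.

Lemma pos_uniform (K : finType) (P : K -> R -> Prop) :
  (forall k, exists2 e, 0 < e & forall e', 0 < e' <= e -> P k e') ->
  exists2 e, 0 < e & forall e', 0 < e' <= e -> forall k, P k e'.
Proof.
move=> Pe; have /choice[e eP] k : exists e, 0 < e /\ forall e', 0 < e' <= e -> P k e'.
  by have [e] := Pe k; exists e.
(* The default 1 keeps the bound positive when [K] is empty. *)
exists (\big[Num.min/1]_k e k).
  by apply/bigmin_gtP; split=> // k _; have [] := eP k.
move=> e' /andP[e'0 e'e] k; have [_] := eP k; apply; rewrite e'0 (le_trans e'e)//.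
exact: bigmin_le.
Qed.

Section OneChart.
Variables (K : finType) (p : T) (r : R) (phi : K -> R -> T).
Hypothesis chart : star_chart p r phi.

Lemma chart_radius : 0 < r. Proof. by case: chart. Qed.

Lemma chart_dist k t : 0 <= t < r -> mdist p (phi k t) = t.
Proof.
case: chart => r0 phi0 _ dphi _ /[dup] tr /andP[t0 _].
by rewrite -(phi0 k) dphi ?lexx// sub0r normrN ger0_norm.
Qed.

Lemma chart_shrink r' : 0 < r' <= r -> star_chart p r' phi.
Proof.
case: chart => r0 phi0 cov dphi dphi' /andP[r'0 r'r].
have ltr't t : 0 <= t < r' -> 0 <= t < r.
  by move=> /andP[-> tr]; exact: lt_le_trans r'r.
split=> // [x xr'|k s t /ltr't s0 /ltr't t0|j k s t jk /ltr't s0 /ltr't t0].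
- have [->|[j [s [/andP[s0 sr] xE]]]] := cov x (lt_le_trans xr' r'r); first by left.
  right; exists j, s; split=> //.
  by move: xr'; rewrite xE chart_dist ?s0// (ltW s0).
- exact: dphi.
- exact: dphi'.
Qed.

Lemma chart_inj j k s t : 0 < s < r -> 0 <= t < r -> phi j s = phi k t ->
  j = k /\ s = t.
Proof.
case: chart => r0 phi0 cov dphi dphi' /andP[s0 sr] tr e.
have sr' : 0 <= s < r by rewrite ltW.
have st : s = t by rewrite -(chart_dist j sr') -(chart_dist k tr) e.
split=> //; apply/eqP/negPn/negP => /dphi'/(_ sr' tr).
by rewrite e mdistxx => /eqP; rewrite eq_sym gt_eqF// -st addr_gt0.
Qed.

Lemma chart_geodesic k : geodesic_from p (phi k).
Proof.
case: chart => r0 phi0 cov dphi dphi'.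
by split=> //; exists r => // s t; exact: dphi.
Qed.

(** A geodesic cannot change branch: points at times [e / 2] and [t] on different branches would be
    at distance [e / 2 + t] instead of [|e / 2 - t|]. *)
Lemma geodesic_chart g : geodesic_from p g ->
  exists k, exists2 e, 0 < e <= r & forall t, 0 <= t < e -> g t = phi k t.
Proof.
case: chart => r0 phi0 cov dphi dphi' [g0 [eps eps0 geo]].
pose e := Num.min eps r.
have e0 : 0 < e by rewrite lt_min eps0.
have ler : e <= r by rewrite ge_min lexx orbT.
have gd s t : 0 <= s < e -> 0 <= t < e -> mdist (g s) (g t) = `|s - t|.
  move=> /andP[s0 +] /andP[t0]; rewrite !lt_min => /andP[se _] /andP[te _].
  by apply: geo; rewrite ?s0 ?t0.
have gp t : 0 < t < e -> exists k, g t = phi k t.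
  move=> /andP[t0 te].
  have gt : mdist p (g t) = t.
    by rewrite -g0 gd ?lexx ?(ltW t0)// sub0r normrN gtr0_norm.
  have [|gtp|[k [s [/andP[s0 sr] gE]]]] := cov (g t).
  - by rewrite gt (lt_le_trans te).
  - by move: t0; rewrite -gt gtp mdistxx ltxx.
  - exists k; rewrite gE; congr (phi k); rewrite -gt gE chart_dist//.
    by rewrite sr ltW.
have [|k gk] := gp (e / 2); first lra.
exists k; exists e; first by rewrite e0.
move=> t /andP[t0 te]; have [<-|tn0] := eqVneq 0 t; first by rewrite g0.
have {}t0 : 0 < t by rewrite lt_def eq_sym tn0.
have [|j gj] := gp t; first by rewrite t0.
have [->//|jk] := eqVneq k j; exfalso.
have := gd (e / 2) t; rewrite gk gj dphi'//; last 2 first.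
- by apply/andP; split; lra.
- by apply/andP; split; lra.
move=> /(_ ltac:(lra) ltac:(lra)); have [te2|te2] := lerP (e / 2 - t) 0.
  by rewrite ler0_norm//; lra.
by rewrite gtr0_norm//; lra.
Qed.

Lemma affine_chart f : germ_affine f -> exists2 e, 0 < e <= r & exists b,
  forall k t, 0 <= t < e -> f (phi k t) = f p + b k * t.
Proof.
move=> af; have := fun k => af p (phi k) (chart_geodesic k).
move=> /choice[b fb]; have r0 := chart_radius.
have [k|e e0 eP] := @pos_uniform K
    (fun k e => forall t, 0 <= t < e -> f (phi k t) = f p + b k * t).
  have [e e0 eP] := fb k; exists e => // e' /andP[e'0 e'e] t /andP[t0 te'].
  by rewrite eP// t0 (lt_le_trans te').
exists (Num.min e r); first by rewrite lt_min e0 r0 ge_min lexx orbT.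
by exists b => k; apply: eP; rewrite lt_min e0 r0 ge_min lexx.
Qed.

Lemma affine_chartI f b : (forall k t, 0 <= t < r -> f (phi k t) = f p + b k * t) ->
  forall g, geodesic_from p g -> exists b', exists2 eps, 0 < eps &
    forall t, 0 <= t < eps -> f (g t) = f p + b' * t.
Proof.
move=> fb g /geodesic_chart[k [e /andP[e0 er] gk]].
exists (b k); exists e => // t /andP[t0 te].
by rewrite gk ?t0// fb// t0 (lt_le_trans te).
Qed.

Lemma germ_eqP (g h : R -> T) : germ g = germ h <->
  exists2 e, 0 < e & forall t, 0 <= t < e -> g t = h t.
Proof.
split=> [gh|[e e0 gh]].
  by have : germ h g by rewrite -gh; exists 1.
apply/seteqP; split=> u [e' e'0 uE]; exists (Num.min e e'); rewrite ?lt_min ?e0//;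
  by move=> t /andP[t0]; rewrite lt_min => /andP[te te']; rewrite uE ?gh ?t0.
Qed.

Lemma chart_tangents : tangents p = range (fun k => germ (phi k)).
Proof.
apply/seteqP; split=> [_ [g gp <-]|_ [k _ <-]].
  have [k [e /andP[e0 er] gk]] := geodesic_chart gp.
  by exists k => //; apply/germ_eqP; exists e => // t /gk.
by exists (phi k) => //; exact: chart_geodesic.
Qed.

Lemma chart_germ_inj : injective (fun k => germ (phi k)).
Proof.
move=> j k /germ_eqP[e e0 jk]; have r0 := chart_radius.
pose t := Num.min e r / 2.
have m0 : 0 < Num.min e r by rewrite lt_min e0.
have [te tr] : Num.min e r <= e /\ Num.min e r <= r.
  by rewrite !ge_min !lexx orbT.
by have [] := @chart_inj j k t t _ _ (jk t _) => //; rewrite /t; lra.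
Qed.

Lemma outgoing_slopeE f g (b e : R) : 0 < e -> geodesic_from p g ->
  (forall t, 0 <= t < e -> f (g t) = f p + b * t) ->
  outgoing_slope f (germ g) = b.
Proof.
move=> e0 [g0 _] fb.
have slope h : germ g h -> (f (h t) - f (h 0)) / t @[t --> 0^'+] --> b.
  move=> [e' e'0 hg].
  have -> : h 0 = p by rewrite hg ?lexx// g0.
  apply: cvg_near_cst; near=> t.
  have t0 : 0 < t by [].
  have te : t < e by near: t; exact: nbhs_right_lt.
  have te' : t < e' by near: t; exact: nbhs_right_lt.
  by rewrite hg ?fb ?(ltW t0)// addrAC subrr add0r mulfK// gt_eqF.
apply: get_unique => [|s sP]; first exact: slope.
have gg : germ g g by exists e.
apply: (cvg_unique _ (sP g gg) (slope g gg)).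
exact: Rhausdorff.
Unshelve. all: by end_near. Qed.

(** Branches and tangent germs correspond bijectively, which turns the finitely supported sum over
    germs into a sum over [K]. *)
Lemma chart_sigma f b e : 0 < e <= r ->
  (forall k t, 0 <= t < e -> f (phi k t) = f p + b k * t) ->
  sigma f p = - \sum_k b k.
Proof.
move=> /andP[e0 er] fb; rewrite /sigma; congr (- _).
rewrite chart_tangents fsbig_image; last by move=> j k _ _; exact: chart_germ_inj.
rewrite [RHS]bigfs ?index_enum_uniq//; last by move=> k; rewrite mem_index_enum.
have -> : [set` (fun=> true : bool) : pred K] = setT by apply/seteqP.
apply: eq_fsbigr => k _.
exact: (outgoing_slopeE e0 (chart_geodesic k) (fb k)).
Qed.

End OneChart.

(** Inside a branch there are two directions: [true] moves away from the center, [false] towards it.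
    The radius keeps both within the branch. *)
Lemma interior_chart (K : finType) p r (phi : K -> R -> T) k t0 :
  star_chart p r phi -> 0 < t0 < r ->
  star_chart (phi k t0) (Num.min t0 (r - t0))
    (fun (b : bool) t => phi k (if b then t0 + t else t0 - t)).
Proof.
move=> chart /andP[t00 t0r]; case: (chart) => r0 phi0 cov dphi dphi'.
set m := Num.min _ _.
have m0 : 0 < m by rewrite lt_min t00 subr_gt0.
have mt : m <= t0 by rewrite ge_min lexx.
have mr : m <= r - t0 by rewrite ge_min lexx orbT.
split=> // [[]|x xm|b s t /andP[s0 sm] /andP[t1 tm]|[] [] s t //= _ /andP[s0 sm] /andP[t1 tm]].
- by rewrite addr0.
- by rewrite subr0.
- have xr : mdist p x < r.
    apply: le_lt_trans (metric_triangle p (phi k t0) x) _.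
    by rewrite (chart_dist chart); lra.
  have [xp|[j [s [/andP[s0 sr] xE]]]] := cov _ xr.
    by exfalso; move: xm; rewrite xp metric_sym (chart_dist chart) {xp}; lra.
  have [jk|jk] := eqVneq j k; last first.
    by exfalso; move: xm; rewrite xE dphi' 1?eq_sym// {xE}; lra.
  move: xm; rewrite xE jk {xE jk} dphi; [|lra|lra] => st.
  have [tt|tt|->] := ltgtP s t0; last by left.
    right; exists false, (t0 - s); split; last by congr (phi k); ring.
    by move: st; rewrite gtr0_norm ?subr_gt0//; lra.
  right; exists true, (s - t0); split; last by congr (phi k); ring.
  by move: st; rewrite ltr0_norm ?subr_lt0//; lra.
- rewrite dphi; [|case: b; lra..].
  case: b; last by rewrite -normrN; congr (`| _ |); ring.
  by congr (`| _ |); ring.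
- by rewrite dphi; [|lra..]; rewrite ger0_norm; lra.
- by rewrite dphi; [|lra..]; rewrite ler0_norm; lra.
Qed.
End Charts.

(** * Maximum principle *)

Section GermAffine.
Context {R : realType} {T : metricType R}.
Implicit Types (p x : T) (f g : T -> R) (r e s t c : R).

Definition has_star_charts := forall p, exists (K : finType) r (phi : K -> R -> T),
  star_chart p r phi.

Lemma germ_affine_cst c : germ_affine (fun _ : T => c : R).
Proof. by move=> p g _; exists 0, 1 => // t _; rewrite mul0r addr0. Qed.

Lemma germ_affine_lin c f g : germ_affine f -> germ_affine g ->
  germ_affine (fun x => c * f x + g x).
Proof.
move=> af ag p h hp; have [a [e1 e10 fE]] := af p h hp.
have [b [e2 e20 gE]] := ag p h hp.
exists (c * a + b), (Num.min e1 e2); first by rewrite lt_min e10.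
move=> t /andP[t0]; rewrite lt_min => /andP[t1 t2].
by rewrite fE ?gE ?t0//; ring.
Qed.

Hypothesis charts : has_star_charts.

Lemma sigma_lin c f g p : germ_affine f -> germ_affine g ->
  sigma (fun x => c * f x + g x) p = c * sigma f p + sigma g p.
Proof.
move=> af ag; have [K [r [phi chart]]] := charts p.
have [e1 /andP[e10 e1r] [a fE]] := affine_chart chart af.
have [e2 /andP[e20 e2r] [b gE]] := affine_chart chart ag.
rewrite (chart_sigma chart _ fE) ?e10// (chart_sigma chart _ gE) ?e20//.
rewrite (@chart_sigma _ _ _ _ _ _ chart _ (fun k => c * a k + b k) (Num.min e1 e2)).
- by rewrite big_split/= -mulr_sumr; ring.
- by rewrite lt_min e10 e20 ge_min e1r.
- move=> k t /andP[t0]; rewrite lt_min => /andP[t1 t2].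
  by rewrite fE ?gE ?t0//; ring.
Qed.

Lemma sigma_cst c p : sigma (fun _ : T => c : R) p = 0.
Proof.
have [K [r [phi chart]]] := charts p.
rewrite (@chart_sigma _ _ _ _ _ _ chart _ (fun=> 0) r) ?big1 ?oppr0//.
  by rewrite lexx (chart_radius chart).
by move=> k t _; rewrite mul0r addr0.
Qed.

Lemma germ_affine_continuous f : germ_affine f -> continuous f.
Proof.
move=> af p; have [K [r [phi chart]]] := charts p.
have [e /andP[e0 er] [b fE]] := affine_chart chart af.
apply/cvgrPdist_lt => eps eps0.
(* A common Lipschitz constant of the branches; the summand 1 makes it positive even if all slopes
   vanish. *)
pose M := 1 + \sum_k `|b k|.
have M0 : 0 < M by rewrite ltr_pwDl// sumr_ge0.
apply/nbhs_ballP; exists (Num.min e (eps / M)) => /=.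
  by rewrite lt_min e0 divr_gt0.
move=> x; rewrite ballEmdist/= lt_min => /andP[xe xM].
case: (chart_shrink chart (r' := e)) => [|_ phi0 cov _ _]; first by rewrite e0.
have [->|[k [t [/andP[t0 te] xE]]]] := cov x xe; first by rewrite subrr normr0.
rewrite xE fE ?(ltW t0)// opprD addrA subrr add0r normrN normrM (gtr0_norm t0).
have bM : `|b k| <= M.
  by rewrite /M (bigD1 k)//= addrCA lerDl addr_ge0// sumr_ge0.
move: xM; rewrite xE (chart_dist chart); last by rewrite (ltW t0) (lt_le_trans te).
rewrite ltr_pdivlMr// mulrC; apply: le_lt_trans.
by rewrite ler_wpM2r// ltW.
Qed.

Lemma sigma_max_ge0 f p e : germ_affine f -> 0 < e ->
  (forall x, mdist p x < e -> f x <= f p) -> 0 <= sigma f p.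
Proof.
move=> af e0 fmax; have [K [r [phi chart]]] := charts p.
have [e1 /andP[e10 e1r] [a fE]] := affine_chart chart af.
rewrite (chart_sigma chart _ fE) ?e10// oppr_ge0 sumr_le0// => k _.
pose t := Num.min e1 e / 2.
have m0 : 0 < Num.min e1 e by rewrite lt_min e10.
have [te1 te] : Num.min e1 e <= e1 /\ Num.min e1 e <= e.
  by rewrite !ge_min !lexx orbT.
have := fmax (phi k t); rewrite fE; last by rewrite /t; lra.
rewrite (chart_dist chart); last by rewrite /t; lra.
move=> /(_ ltac:(rewrite /t; lra)); rewrite gerDl pmulr_lle0//.
by rewrite /t; lra.
Qed.

(** At a local maximum all outgoing slopes are nonpositive; if moreover their sum is nonnegative,
    they all vanish. *)
Lemma sigma_max_near f p e : germ_affine f -> 0 < e ->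
  (forall x, mdist p x < e -> f x <= f p) -> sigma f p <= 0 ->
  exists2 d, 0 < d & forall x, mdist p x < d -> f x = f p.
Proof.
move=> af e0 fmax; have [K [r [phi chart]]] := charts p.
have [e1 /andP[e10 e1r] [a fE]] := affine_chart chart af.
rewrite (chart_sigma chart _ fE) ?e10// oppr_le0 => a0.
have ale0 k : a k <= 0.
  pose t := Num.min e1 e / 2.
  have m0 : 0 < Num.min e1 e by rewrite lt_min e10.
  have [te1 te] : Num.min e1 e <= e1 /\ Num.min e1 e <= e.
    by rewrite !ge_min !lexx orbT.
  have := fmax (phi k t); rewrite fE; last by rewrite /t; lra.
  rewrite (chart_dist chart); last by rewrite /t; lra.
  move=> /(_ ltac:(rewrite /t; lra)); rewrite gerDl pmulr_lle0//.
  by rewrite /t; lra.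
have {}a0 k : a k = 0.
  have /eqP : \sum_k - a k = 0.
    apply/eqP; rewrite eq_le sumrN oppr_le0 a0 oppr_ge0/= sumr_le0//.
  rewrite psumr_eq0; last by move=> j _; rewrite oppr_ge0.
  by move=> /allP/(_ k); rewrite mem_index_enum oppr_eq0 => /(_ isT)/eqP.
exists e1 => // x xe1.
case: (chart_shrink chart (r' := e1)) => [|_ phi0 cov _ _]; first by rewrite e10.
have [->//|[k [t [/andP[t0 te] ->]]]] := cov x xe1.
by rewrite fE ?a0 ?mul0r ?addr0// te ltW.
Qed.

(** The set of points of [D] where the maximum is attained is closed by continuity and open by
    [sigma_max_near]. It serves with [D] the whole space and with [D] an edge. *)
Lemma connected_const_max f D p0 : connected [set: T] -> germ_affine f ->
  closed D -> D p0 -> (forall x, D x -> f x <= f p0) ->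
  (forall p, D p -> f p = f p0 ->
    (exists2 e, 0 < e & forall x, mdist p x < e -> D x) /\ sigma f p <= 0) ->
  forall x, D x /\ f x = f p0.
Proof.
move=> conT af cD Dp0 fmax loc x.
suff ST : D `&` f @^-1` [set f p0] = setT.
  by have : (D `&` f @^-1` [set f p0]) x by rewrite ST.
have cS : closed (D `&` f @^-1` [set f p0]).
  apply: closedI => //; apply: closed_comp.
    by move=> y _; exact: germ_affine_continuous.
  exact: closed_eq.
apply: conT; first by exists p0.
- exists (D `&` f @^-1` [set f p0]); last by rewrite setTI.
  rewrite openE => p [Dp fp]; have [[e e0 eD] sp] := loc p Dp fp.
  have [|d d0 fd] := sigma_max_near af e0 _ sp.
    by move=> y /eD/fmax; rewrite fp.
  apply/nbhs_ballP; exists (Num.min e d) => /=; first by rewrite lt_min e0.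
  move=> y; rewrite ballEmdist/= lt_min => /andP[ye yd].
  by split; [exact: eD|rewrite /= fd].
- by exists (D `&` f @^-1` [set f p0]) => //; rewrite setTI.
Qed.

Hypotheses (cT : compact [set: T]) (conT : connected [set: T]).

(** If the maximum were not attained at [x], the sign of [sigma f] would let it propagate from any
    point where it is attained to the whole space, hence to [x]. *)
Lemma max_principle f x : germ_affine f ->
  (forall p, p != x -> sigma f p <= 0) -> forall p, f p <= f x.
Proof.
move=> af sf p; have [||p0 _ fmax] := @compact_EVT_max _ _ f setT _ cT.
- by exists p.
- by apply: continuous_subspaceT; exact: germ_affine_continuous.
have {}fmax q : f q <= f p0 by apply: fmax; rewrite inE.
have [fx|fx] := eqVneq (f x) (f p0); first by rewrite fx.
have := @connected_const_max f setT p0 conT af closedT I (fun x _ => fmax x) _ x.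
case=> [q _ fq|_ fxE]; last by rewrite fxE.
split; first by exists 1.
by apply: sf; apply: contraNneq fx => <-; rewrite fq.
Qed.

Lemma sigma0_const f : germ_affine f -> (forall p, sigma f p = 0) ->
  forall p x, f p = f x.
Proof.
move=> af sf p x; apply/eqP; rewrite eq_le.
by rewrite !max_principle// => q _; rewrite sf.
Qed.

Lemma sigma_inj f g : germ_affine f -> germ_affine g -> sigma f = sigma g ->
  forall p x, f p - f x = g p - g x.
Proof.
move=> af ag fg p x.
have := @sigma0_const _ (germ_affine_lin (-1) af ag) _ p x.
move=> /(_ _)/[!mulN1r] H.
have {}H : - f p + g p = - f x + g x.
  by rewrite H// => q; rewrite sigma_lin// fg mulN1r addNr.
by lra.
Qed.

End GermAffine.

(** * Potentials by duality *)

(** A maximal subspace [M] containing [I] and avoiding [v] is a complement of the line spanned by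
    [v], and [L] reads the coefficient along [v]. *)
Lemma separating_functional (F : fieldType) (V : lmodType F) (I : set V) v :
  I 0 -> (forall a u w, I u -> I w -> I (a *: u + w)) -> ~ I v ->
  exists L : {linear V -> F^o}, (forall u, I u -> L u = 0) /\ L v = 1.
Proof.
move=> I0 Ilin Iv.
pose lin (N : set V) := forall a u w, N u -> N w -> N (a *: u + w).
(* Zorn's lemma also asks for the union of the empty chain, which is empty and not a subspace;
   adding [I] to [N] covers this case. *)
pose P := [set N | lin (I `|` N) /\ ~ N v].
have [N [[Nlin Nv] Nmax]] : exists A, P A /\ forall B, A `<` B -> ~ P B.
  apply: Zorn_bigcup => C CP Ctot; split; last by move=> [X /CP[_]].
  move=> a u w [Iu|[X CX Xu]] [Iw|[Y CY Yw]].
  - by left; exact: Ilin.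
  - have [H _] := CP _ CY; case: (H a u w); [by left|by right|by left|].
    by right; exists Y.
  - have [H _] := CP _ CX; case: (H a u w); [by right|by left|by left|].
    by right; exists X.
  - have [Z [CZ Zu Zw]] : exists Z, [/\ C Z, Z u & Z w].
      have [XY|YX] := Ctot _ _ CX CY; [exists Y|exists X]; split=> //.
        exact: XY.
      exact: YX.
    have [H _] := CP _ CZ; case: (H a u w); [by right|by right|by left|].
    by right; exists Z.
set M := I `|` N in Nlin.
have Mv : ~ M v by case.
have M0 : M 0 by left.
have Mscale a u : M u -> M (a *: u).
  by move=> Mu; rewrite -[a *: u]addr0; exact: Nlin.
have dec u : exists c, M (u - c *: v).
  have [Mu|Mu] := pselect (M u); first by exists 0; rewrite scale0r subr0.
  (* [B] is [M] enlarged by [u]. By maximality it contains [v], with a nonzero coefficient of [u]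
     because [v] is not in [M]; solving for [u] gives the decomposition. *)
  pose B := [set x | exists c, M (x - c *: u)].
  have MB : M `<=` B by move=> x Mx; exists 0; rewrite scale0r subr0.
  have Bu : B u by exists 1; rewrite scale1r subrr.
  have Blin : lin B.
    move=> a x y [c Mx] [d My]; exists (a * c + d).
    have := Nlin a _ _ Mx My; congr M.
    by rewrite scalerBr scalerA scalerDl opprD addrACA.
  have [c Mc] : B v.
    apply: contrapT => nBv; apply: (Nmax B).
      rewrite properEneq; split; last by move=> x Nx; apply: MB; right.
      by apply/eqP => NB; apply: Mu; right; rewrite NB.
    by split=> //; rewrite (_ : I `|` B = B)//; apply/setUidPr => x Ix; apply: MB; left.
  have c0 : c != 0 by apply: contra_not_neq Mv => c0; move: Mc; rewrite c0 scale0r subr0.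
  exists c^-1; have := Mscale (- c^-1) _ Mc; congr M.
  by rewrite scalerBr scalerA mulNr mulVf// scaleNr !scaleN1r opprK addrC.
have uniq u c d : M (u - c *: v) -> M (u - d *: v) -> c = d.
  move=> Mc Md; apply/eqP; rewrite -subr_eq0; apply: contra_notT Mv => cd.
  have := Nlin (-1) _ _ Mc Md.
  rewrite scaleN1r opprB addrA subrK -scalerBl.
  by move=> /(Mscale (c - d)^-1); rewrite scalerA mulVf// scale1r.
have [L LP] := choice dec.
have Llin : linear (L : V -> F^o).
  move=> a u w; apply: (uniq (a *: u + w)) => //.
  have := Nlin a _ _ (LP u) (LP w); congr M.
  by rewrite scalerBr scalerA scalerDl opprD addrACA.
pose lL := GRing.isLinear.Build F V F^o _ L Llin.
exists (HB.pack L lL : {linear V -> F^o}); split=> [u Iu|] /=.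
- by apply: (uniq u) => //; rewrite scale0r subr0; left.
- by apply: (uniq v) => //; rewrite scale1r subrr.
Qed.

(** For nonzero [c], the radius [|c| / (|d| + 1)] preserves the sign of [c + d * t]; for [c = 0],
    the sign of [d] decides. *)
Lemma max0_affine (R : realFieldType) (c d : R) :
  exists2 e, 0 < e & forall t, 0 <= t < e ->
    Num.max 0 (c + d * t) = Num.max 0 c +
      (if 0 < c then d else if c < 0 then 0 else Num.max 0 d) * t.
Proof.
have M0 : 0 < `|d| + 1 by rewrite ltr_wpDl.
have dt t : 0 <= t -> `|d * t| <= (`|d| + 1) * t.
  by move=> t0; rewrite normrM (ger0_norm t0) ler_wpM2r// lerDl.
case: (ltgtP c 0) => [c0|c0|->].
- exists (- c / (`|d| + 1)); first by rewrite divr_gt0// oppr_gt0.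
  move=> t /andP[t0]; rewrite ltr_pdivlMr// mulrC => tc.
  have := dt t t0; rewrite ler_norml => /andP[_ dtu].
  by rewrite mul0r addr0 !max_l//; lra.
- exists (c / (`|d| + 1)); first by rewrite divr_gt0.
  move=> t /andP[t0]; rewrite ltr_pdivlMr// mulrC => tc.
  have := dt t t0; rewrite ler_norml => /andP[dtl _].
  by rewrite !max_r//; lra.
- exists 1 => // t /andP[t0 _]; rewrite ?maxxx !add0r.
  have [d0|d0] := leP 0 d; first by rewrite max_r// mulr_ge0.
  by rewrite mul0r max_l// mulr_le0_ge0// ltW.
Qed.

(** * Tent functions on small stars *)

Section Cone.
Context {R : realType} {T : metricType R}.
Hypothesis charts : @has_star_charts R T.
Variables (K : finType) (p : T) (r : R) (phi : K -> R -> T) (rho : K -> R).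
Hypothesis chart : star_chart p r phi.
Hypothesis rhoP : forall k, 0 < rho k <= r / 2.

(** The tent of height 1 at [p] that decreases linearly to 0 at distance [rho k] on branch [k]. A
    chart has no inverse map, so the branch of [x] is found by testing all of them, and the distance
    to [p] is the coordinate on it. The apex, on no branch with [t > 0], is set apart. *)
Definition cone (x : T) : R :=
  if x == p then 1 else
    \sum_k if `[< exists t, 0 < t < r /\ x = phi k t >]
           then Num.max 0 (1 - mdist p x / rho k) else 0.

Let r0 : 0 < r := chart_radius chart.
Let rho0 k : 0 < rho k. Proof. by have /andP[] := rhoP k. Qed.
Let phi0 k : phi k 0 = p. Proof. by case: chart. Qed.

Lemma cone_branch k t : 0 <= t < r -> cone (phi k t) = Num.max 0 (1 - t / rho k).
Proof.
move=> tr; rewrite /cone; have [tp|tp] := eqVneq.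
  have -> : t = 0 by rewrite -(chart_dist chart k tr) tp mdistxx.
  by rewrite mul0r subr0 max_r.
have t0 : 0 < t.
  by move: tr => /andP[t0 _]; rewrite lt_def t0 andbT; apply: contra_neq tp => ->.
rewrite (bigD1 k)//= big1 => [|j jk].
  case: asboolP => [_|]; first by rewrite addr0 (chart_dist chart).
  by case; exists t; split=> //; rewrite t0; case/andP: tr.
case: asboolP => // -[s [sr /esym stk]].
by have [jkE _] := chart_inj chart sr tr stk; rewrite jkE eqxx in jk.
Qed.

Lemma cone_apex : cone p = 1. Proof. by rewrite /cone eqxx. Qed.

Lemma cone_out x : r / 2 <= mdist p x -> cone x = 0.
Proof.
move=> xr; rewrite /cone; have [xp|_] := eqVneq.
  by move: xr; rewrite xp mdistxx => H; exfalso; have := r0; lra.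
apply: big1 => k _; case: asboolP => // _; apply: max_l.
rewrite subr_le0 ler_pdivlMr// mul1r.
by have /andP[_ /le_trans] := rhoP k; apply.
Qed.

(** Three kinds of points: off the star, the apex, and points of an open branch, where the only kink
    is at distance [rho k]. Germ affinity and the Laplacian of the cone are both read off these
    charts. *)
Lemma cone_local q : exists (K' : finType) r' (phi' : K' -> R -> T) e b,
  [/\ star_chart q r' phi', 0 < e <= r',
    forall k t, 0 <= t < e -> cone (phi' k t) = cone q + b k * t &
    - \sum_k b k =
      \sum_k (rho k)^-1 * ((q == p)%:R - (q == phi k (rho k))%:R)].
Proof.
have rhor k : 0 < rho k < r by have /andP[] := rhoP k; lra.
have rhop k : (p == phi k (rho k)) = false.
  apply/negP => /eqP e; have := @chart_dist _ _ _ _ _ _ chart k (rho k).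
  by rewrite -e mdistxx => /(_ ltac:(have := rhor k; lra)); have := rho0 k; lra.
have [qr|qr] := ltP (mdist p q) r; last first.
  have [K' [r' [phi' chart']]] := charts q.
  (* Points within [r / 2] of [q] are at distance at least [r / 2] from [p], where the cone
     vanishes. *)
  exists K', r', phi', (Num.min r' (r / 2)), (fun=> 0).
  have r'0 := chart_radius chart'.
  split=> //; first by rewrite lt_min r'0 ge_min lexx divr_gt0.
    move=> k t /andP[t0]; rewrite lt_min => /andP[tr' tr2].
    rewrite mul0r addr0 (cone_out (x := q)) ?cone_out//; last by lra.
    have := metric_triangle p (phi' k t) q.
    by rewrite (metric_sym (phi' k t) q) (chart_dist chart') ?t0//; lra.
  rewrite big1 ?oppr0// big1// => k _; apply/eqP.
  rewrite mulf_eq0 invr_eq0 (gt_eqF (rho0 k))/=.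
  have [qp|_] := eqVneq q p; first by move: qr; rewrite qp mdistxx => H; have := r0; lra.
  have [qp|_] := eqVneq q; last by rewrite subrr.
  by move: qr; rewrite qp (chart_dist chart); have := rhor k; lra.
have [_ _ cov _ _] := chart.
have [->|[k [t0 [/andP[t00 t0r] qE]]]] := cov q qr.
  have [k|e e0 eP] := @pos_uniform R K (fun k e => e <= rho k).
    by exists (rho k) => // e /andP[].
  exists K, r, phi, (Num.min r e), (fun k => - (rho k)^-1); split=> //.
  - by rewrite lt_min r0 e0 ge_min lexx.
  - move=> k t /andP[t0]; rewrite lt_min => /andP[tr te].
    rewrite cone_branch ?t0// cone_apex max_r; first by ring.
    rewrite subr_ge0 ler_pdivrMr// mul1r (le_trans (ltW te))// eP//.
    by rewrite e0 lexx.
  - by rewrite sumrN opprK; apply: eq_bigr => k _; rewrite eqxx rhop subr0 mulr1.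
(* The height at [q] before truncation at 0: its sign tells whether [q] is before, at or beyond the
   foot of the tent. *)
set c := 1 - t0 / rho k.
have [e1 e10 e1P] := max0_affine c (- (rho k)^-1).
have [e2 e20 e2P] := max0_affine c (rho k)^-1.
have t0P : 0 < t0 < r by rewrite t00.
have := interior_chart k chart t0P; rewrite -qE => chart'.
set m := Num.min _ _ in chart'.
have m0 := chart_radius chart'.
have mt : m <= t0 by rewrite /m ge_min lexx.
have mr : m <= r - t0 by rewrite /m ge_min lexx orbT.
clearbody m.
exists bool, m, (fun b t => phi k (if b then t0 + t else t0 - t)),
  (Num.min m (Num.min e1 e2)), (fun b : bool =>
   if b then if 0 < c then - (rho k)^-1 else if c < 0 then 0 else Num.max 0 (- (rho k)^-1)
   else if 0 < c then (rho k)^-1 else if c < 0 then 0 else Num.max 0 (rho k)^-1).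
split=> //; first by rewrite !lt_min m0 e10 e20 ge_min lexx.
  move=> b t /andP[t1]; rewrite !lt_min => /andP[tm /andP[te1 te2]].
  rewrite qE !cone_branch; last 2 first.
  - by rewrite t0r ltW.
  - by case: b; lra.
  rewrite -/c; case: b.
    by rewrite -e1P ?t1// /c; congr (Num.max _ _); ring.
  by rewrite -e2P ?t1// /c; congr (Num.max _ _); ring.
have qp : (q == p) = false.
  apply/negP => /eqP qp; have := @chart_dist _ _ _ _ _ _ chart k t0.
  by rewrite -qE qp mdistxx => /(_ ltac:(lra)); lra.
have iv : 0 < (rho k)^-1 by rewrite invr_gt0.
rewrite [RHS](bigD1 k)//= [X in _ + X]big1 ?addr0 => [|j jk]; last first.
  rewrite qp; have [qj|_] := eqVneq q; last by rewrite subrr mulr0.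
  have [kj] := @chart_inj _ _ _ _ _ _ chart k j t0 (rho j) ltac:(lra)
    ltac:(have := rhor j; lra) ltac:(by rewrite -qE).
  by rewrite kj eqxx in jk.
have -> : (q == phi k (rho k)) = (t0 == rho k).
  apply/eqP/eqP => [qk|<-//].
  by have [] := @chart_inj _ _ _ _ _ _ chart k k t0 (rho k) ltac:(lra)
    ltac:(have := rhor k; lra) ltac:(by rewrite -qE).
rewrite qp big_bool/=; have rk := rho0 k.
have [t0k|t0k|t0k] := ltgtP t0 (rho k).
- have -> : 0 < c by rewrite subr_gt0 ltr_pdivrMr// mul1r.
  by rewrite addNr subrr mulr0 oppr0.
- have c0 : c < 0 by rewrite subr_lt0 ltr_pdivlMr// mul1r.
  by rewrite c0 ltNge (ltW c0)/= addr0 subrr mulr0 oppr0.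
- have -> : c = 0 by rewrite /c t0k divff ?subrr// gt_eqF.
  rewrite ltxx max_l; last by rewrite oppr_le0 ltW.
  by rewrite max_r ?(ltW iv)// add0r sub0r mulrN1.
Qed.

Lemma cone_germ_affine : germ_affine cone.
Proof.
move=> q g gq; have [K' [r' [phi' [e [b [chart' er' ab _]]]]]] := cone_local q.
exact: (affine_chartI (chart_shrink chart' er') ab).
Qed.

Lemma cone_sigma q : sigma cone q =
  \sum_k (rho k)^-1 * ((q == p)%:R - (q == phi k (rho k))%:R).
Proof.
have [K' [r' [phi' [e [b [chart' er' ab <-]]]]]] := cone_local q.
exact: (chart_sigma chart' er' ab).
Qed.

End Cone.

Section Potential.
Context {R : realType} {T : metricType R}.
Implicit Types (p q x y a b : T) (f g h : T -> R).
Hypotheses (charts : @has_star_charts R T).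

Definition dirac_diff a b (q : T) : R := (q == a)%:R - (q == b)%:R.

(** Changing the radius of branch [k] alone, from [r] to [t], leaves all other terms of the mean
    value identity unchanged; hence the difference quotient of [h] on branch [k] does not depend on
    [t]. *)
Lemma mean_value_affine (K : finType) p r (phi : K -> R -> T) h : 0 < r ->
  (forall k, phi k 0 = p) ->
  (forall rho : K -> R, (forall k, 0 < rho k <= r) ->
    \sum_k (rho k)^-1 * (h p - h (phi k (rho k))) = 0) ->
  exists2 b : K -> R, \sum_k b k = 0 &
    forall k t, 0 <= t < r -> h (phi k t) = h p + b k * t.
Proof.
move=> r0 phi0 mean; exists (fun k => r^-1 * (h (phi k r) - h p)).
  apply/eqP; rewrite -oppr_eq0 -sumrN -[X in _ == X](mean (fun=> r)).
    by apply/eqP; apply: eq_bigr => k _; ring.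
  by move=> k; rewrite r0 lexx.
move=> k t /andP[t0 tr]; have [<-|tn0] := eqVneq 0 t.
  by rewrite phi0 mulr0 addr0.
have {tn0}t0 : 0 < t by rewrite lt_def eq_sym tn0.
have := mean (fun=> r); rewrite (bigD1 k)//= => Hr.
have := mean (fun j => if j == k then t else r); rewrite (bigD1 k)//= eqxx.
under eq_bigr => j /negPf jk do rewrite jk.
move=> Ht.
have {}Ht : t^-1 * (h p - h (phi k t)) = r^-1 * (h p - h (phi k r)).
  apply: (addIr (\sum_(j | j != k) r^-1 * (h p - h (phi j r)))).
  rewrite Ht ?Hr// => j; first by rewrite r0 lexx.
  by case: ifP => _; rewrite ?t0 ?r0 ?lexx ?ltW.
have : h p - h (phi k t) = t * (r^-1 * (h p - h (phi k r))).
  by rewrite -Ht mulrA divff ?mul1r// gt_eqF.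
by move=> H; rewrite -[LHS](subKr (h p)) H; ring.
Qed.

Hypotheses (cT : compact [set: T]) (conT : connected [set: T]).

Lemma sum_pair (V W : nmodType) (K : finType) (F : K -> V * W) :
  \sum_k F k = (\sum_k (F k).1, \sum_k (F k).2).
Proof.
rewrite [LHS]surjective_pairing; congr (_, _).
  exact: (big_morph fst).
exact: (big_morph snd).
Qed.

Lemma dirac_pair_expand (K : finType) (a : K -> R) (F : T -> R^o) p (q : K -> T)
    (c : R^o) :
  (forall z, F z = \sum_k a k * ((z == p)%:R - (z == q k)%:R)) ->
  (F, c) = \sum_k a k *: ((fun z => (z == p)%:R : R^o, 0 : R^o)
                          - (fun z => (z == q k)%:R : R^o, 0)) + c *: (0, 1)
    :> ((T -> R^o) * R^o)%type.
Proof.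
move=> FE; rewrite sum_pair [RHS]surjective_pairing; congr (_, _).
  apply/funext => z; rewrite FE [RHS]/= !fctE scaler0 addr0 fct_sumE.
  by apply: eq_bigr.
rewrite /= big1 => [|k _]; last by rewrite subrr scaler0.
by rewrite add0r /GRing.scale/= mulr1.
Qed.

(* The pairs (sigma u, u x - u y) form a subspace. If (delta_a - delta_b, f a - f b)
   were not in it, some functional (m, c) |-> L m + l c would vanish on it and not
   there; evaluated on the small cones, it shows that p |-> L delta_p + l f p has the
   mean value property, hence is constant: a contradiction. *)
Lemma dual_potential f x y a b : germ_affine f -> sigma f = dirac_diff x y ->
  exists u, [/\ germ_affine u, sigma u = dirac_diff a b & u x - u y = f a - f b].
Proof.
move=> af sf; pose V := ((T -> R^o) * R^o)%type.
pose I : set V := [set v | exists u : T -> R,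
  [/\ germ_affine u, sigma u = v.1 & u x - u y = v.2]].
suff : I (dirac_diff a b, f a - f b) by [].
apply: contrapT => nI.
have I0 : I 0.
  exists (fun=> 0); split; [exact: germ_affine_cst| |exact: subrr].
  by apply/funext => q; rewrite sigma_cst.
have Ilin (c : R) (v w : V) : I v -> I w -> I (c *: v + w).
  move=> [u [au su uv]] [u' [au' su' uv']]; exists (fun x => c * u x + u' x).
  split; first exact: germ_affine_lin.
    by apply/funext => q; rewrite sigma_lin// su su'.
  by rewrite /= -uv -uv' /GRing.scale/=; ring.
have [L [LI Lab]] := separating_functional I0 Ilin nI.
pose d q : V := (fun q' => (q' == q)%:R : R^o, 0).
pose l := L (0, 1); pose h q : R := L (d q) + l * f q.
have dE p q c : (dirac_diff p q, c) = d p - d q + c *: (0, 1) :> V.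
  rewrite /d; congr pair.
    by apply/funext => z; rewrite /dirac_diff/= !fctE/= scaler0 addr0.
  by rewrite /= subr0 add0r /GRing.scale/= mulr1.
have LdE p q c : L (dirac_diff p q, c) = L (d p) - L (d q) + c * l.
  by rewrite dE linearD linearB linearZ.
have hloc p : exists (K : finType) r (phi : K -> R -> T) (b' : K -> R), [/\ star_chart p r phi,
    \sum_k b' k = 0 & forall k t, 0 <= t < r -> h (phi k t) = h p + b' k * t].
  have [K [r0 [phi chart0]]] := charts p.
  have [r1 /andP[r10 r1r] [bf fE]] := affine_chart chart0 af.
  (* The radius is taken so small that [x] and [y] lie outside the support of the cones at [p],
     unless they equal [p]. *)
  pose away z := if z == p then r1 else mdist p z.
  have away0 z : 0 < away z.
    by rewrite /away; case: eqVneq => // zp; rewrite mdist_gt0 eq_sym.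
  pose r := Num.min r1 (Num.min (away x) (away y)).
  have r_gt0 : 0 < r by rewrite !lt_min r10 !away0.
  have rr1 : r <= r1 by rewrite ge_min lexx.
  have chart : star_chart p r phi.
    by apply: (chart_shrink chart0); rewrite r_gt0 (le_trans rr1).
  have coneE rho (rhoP : forall k, 0 < rho k <= r / 2) z : r <= away z ->
      cone p r phi rho z = (p == z)%:R.
    move=> rz; rewrite [p == z]eq_sym; have [->|zp] := eqVneq z p; first exact: cone_apex.
    apply: (cone_out chart rhoP); move: rz; rewrite /away (negPf zp); lra.
  have [|||b' b0 hb] := @mean_value_affine K p (r / 2) phi h.
  - by rewrite divr_gt0.
  - by move=> k; case: chart.
  - move=> rho rhoP; pose u := cone p r phi rho.
    have : L (sigma u, u x - u y) = 0.
      by apply: LI; exists u; split=> //; exact: (cone_germ_affine charts chart rhoP).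
    have -> : (sigma u, u x - u y) = \sum_k (rho k)^-1 *: (d p - d (phi k (rho k)))
        + (u x - u y) *: (0, 1) :> V.
      exact/dirac_pair_expand/(cone_sigma charts chart rhoP).
    rewrite linearD linear_sum linearZ/= -/l => LE.
    (* Each of [u x] and [u y] is 1 or 0 according to whether the point is [p]; their difference is
       thus the mass of [sigma f] at [p], a sum of slopes of [f]. This converts the second component
       into the differences of [f] that the mean value identity for [h] requires. *)
    have uxy : u x - u y = - \sum_k bf k.
      rewrite /u !coneE//; last 2 first.
      + by rewrite !ge_min lexx !orbT.
      + by rewrite !ge_min lexx !orbT.
      by rewrite -(chart_sigma chart0 _ fE) ?r10// sf.
    apply: etrans LE; rewrite uxy -sumrN.
    rewrite (_ : _ *: l = (\sum_k - bf k) * l)// mulr_suml -big_split/=.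
    apply: eq_bigr => k _.
    have /andP[rk0 rk] := rhoP k.
    rewrite linearZ linearB/= /h fE; last by rewrite ltW//=; lra.
    have : (rho k)^-1 * (rho k) = 1 by rewrite mulVf// gt_eqF.
    move=> rkE; rewrite /GRing.scale/=; ring: rkE.
  exists K, (r / 2), phi, b'; split=> //.
  by apply: (chart_shrink chart); lra.
have ah : germ_affine h.
  move=> p g gp; have [K [r [phi [b' [chart _ hb]]]]] := hloc p.
  exact: (affine_chartI chart hb).
have sh p : sigma h p = 0.
  have [K [r [phi [b' [chart b0 hb]]]]] := hloc p.
  by rewrite (chart_sigma chart _ hb) ?b0 ?oppr0// lexx (chart_radius chart).
(* The equality [h a = h b] says that [L] vanishes on the pair where it was normalized to 1. *)
have := sigma0_const charts cT conT ah sh a b.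
rewrite /h => hab; have := Lab; rewrite LdE => Lab'.
have : (1 : R) = 0 by rewrite -Lab'; lra.
by move/eqP; rewrite oner_eq0.
Qed.
End Potential.

(** * Paths and geodesics *)

Section Paths.
Context {R : realType} {T : metricType R}.
Implicit Types (A : set T) (x y : T) (g : R -> T).

Definition isometric_on (D : set R) g :=
  forall s t, D s -> D t -> mdist (g s) (g t) = `|s - t|.

Lemma nonexpansive_continuous (D : set R) g :
  (forall s t, D s -> D t -> mdist (g s) (g t) <= `|s - t|) ->
  {within D, continuous g}.
Proof.
move=> lip; apply/subspace_continuousP => t Dt B /nbhs_ballP[e /= e0 eB].
apply/nbhs_ballP; exists e => // s; rewrite -ball_normE/= => ts Ds.
by apply: eB; rewrite ballEmdist/= (le_lt_trans (lip _ _ Dt Ds)).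
Qed.

Lemma isometric_continuous (D : set R) g : isometric_on D g ->
  {within D, continuous g}.
Proof. by move=> iso; apply: nonexpansive_continuous => s t Ds Dt; rewrite iso. Qed.

Lemma mdist_le_path_dist A x y : ((mdist x y)%:E <= path_dist A x y)%E.
Proof.
apply: le_ereal_inf_tmp => _ [g [_ g0 g1 _] <-].
apply: ereal_sup_ubound; exists [:: 1]; first exact: itv_partition1.
by rewrite /= big_nat1/= g0 g1.
Qed.

(** The affine run along [g] from [s] to [t] stays in [A], and each of its inscribed chains
    telescopes to [|s - t|]; the ambient distance gives the lower bound. This carries ambient
    geodesics over to the path metric of a subset. *)
Lemma path_dist_isometric A g a b s t : isometric_on `[a, b] g ->
  g @` `[a, b] `<=` A -> a <= s <= b -> a <= t <= b ->
  path_dist A (g s) (g t) = `|s - t|%:E.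
Proof.
move=> iso gA sab tab.
have stab u : `[0, 1]%classic u -> `[a, b]%classic (s + (t - s) * u).
  rewrite /= !in_itv/= => /andP[u0 u1]; apply/andP; split; nra.
apply/eqP; rewrite eq_le; apply/andP; split; last first.
  rewrite -(iso s t) ?/(`[a, b]%classic _)/= ?in_itv//.
  exact: mdist_le_path_dist.
apply: ge_ereal_inf; exists (path_length (fun u => g (s + (t - s) * u))).
  exists (fun u => g (s + (t - s) * u)) => //; split.
  - apply/subspace_continuousP => u Du B /nbhs_ballP[e /= e0 eB].
    have M0 : 0 < 1 + `|t - s| by rewrite ltr_pwDl.
    apply/nbhs_ballP; exists (e / (1 + `|t - s|)); first by rewrite /= divr_gt0.
    move=> v; rewrite -ball_normE/= ltr_pdivlMr// => uv Dv.
    apply: eB; rewrite ballEmdist/= iso; [|exact: stab..].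
    apply: le_lt_trans uv.
    rewrite (_ : _ - _ = (u - v) * (t - s)); last by ring.
    by rewrite normrM ler_wpM2l// lerDr.
  - by rewrite mulr0 addr0.
  - by congr g; ring.
  - by move=> _ [u /stab u01 <-]; apply: gA; exists (s + (t - s) * u).
apply: ge_ereal_sup => _ [l lpart <-]; rewrite lee_fin.
have l01 i : (i < (size l).+1)%N -> 0 <= nth 1 (0 :: l) i <= 1.
  by move=> il; rewrite (itv_partition_nth_ge il lpart) (itv_partition_nth_le il lpart).
rewrite (eq_big_nat _ _ (F2 := fun i =>
    `|s - t| * (nth 1 (0 :: l) i.+1 - nth 1 (0 :: l) i))) => [|i /andP[_ il]].
  rewrite -mulr_sumr (telescope_sumr (fun i => nth 1 (0 :: l) i))//.
  by rewrite (itv_partition_nth_size _ lpart) subr0 mulr1.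
have hi := l01 i (ltnW il); have hi1 := l01 i.+1 il.
rewrite iso; [|by apply: stab; rewrite /= in_itv..].
rewrite (_ : _ - _ = (s - t) * (nth 1 (0 :: l) i.+1 - nth 1 (0 :: l) i)); last by ring.
rewrite normrM [`|_ - nth _ _ _|]ger0_norm// subr_ge0.
have [so _] := lpart.
apply/ltW/(sorted_ltn_nth lt_trans 1 (s := 0 :: l) so) => //.
by rewrite inE/= ltnS ltnW.
Qed.

End Paths.

(** Each [u x - u 0] is [x] or [- x], and opposite signs at two positive points would put their
    images at distance [x + x1]. One positive point therefore fixes the sign for all. *)
Lemma isometry_affine (R : realFieldType) (D : set R) (u : R -> R) :
  D 0 -> (forall x, D x -> 0 <= x) ->
  (forall x y, D x -> D y -> `|u x - u y| = `|x - y|) ->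
  exists c, forall x, D x -> u x = u 0 + c * x.
Proof.
move=> D0 Dge0 iso.
have [[x1 [Dx1 x10]]|nD] := pselect (exists x, D x /\ 0 < x); last first.
  exists 0 => x Dx; have [->|x0] := eqVneq x 0; first by rewrite mul0r addr0.
  by exfalso; apply: nD; exists x; rewrite lt_def x0 Dge0.
have signs x : D x -> u x - u 0 = x \/ u x - u 0 = - x.
  move=> Dx; have := iso x 0 Dx D0; rewrite subr0 (ger0_norm (Dge0 _ Dx)).
  by case: (ger0P (u x - u 0)) => H; [left|right]; lra.
exists ((u x1 - u 0) / x1) => x Dx.
have := iso x x1 Dx Dx1; have := Dge0 x Dx.
have x1n : x1 / x1 = 1 by rewrite divff// gt_eqF.
have [E1|E1] := signs x1 Dx1; have [E|E] := signs x Dx; rewrite E1 ?mulNr x1n.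
- by lra.
- rewrite (_ : u x - u x1 = - (x + x1)); last by lra.
  rewrite normrN => x0; rewrite ger0_norm; last by lra.
  by case: (ger0P (x - x1)); lra.
- rewrite (_ : u x - u x1 = x + x1); last by lra.
  move=> x0; rewrite ger0_norm; last by lra.
  by case: (ger0P (x - x1)); lra.
- by lra.
Qed.

(** * Piecewise affine functions are affine along germs *)

Section PLGerms.
Context {R : realType} {T : metricType R}.
Implicit Types (p x : T) (f : T -> R) (V C : set T).

Lemma finite_set_avoid V p : finite_set V ->
  exists2 e : R, 0 < e & forall x, mdist p x < e -> V x -> x = p.
Proof.
move=> finV; have cV : closed (V `\ p).
  apply: (accessible_finite_set_closed.1 (hausdorff_accessible _)).
    exact: metric_hausdorff.
  exact: finite_setD.
have : nbhs p (~` (V `\ p)).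
  by apply: open_nbhs_nbhs; split; [exact: closed_openC|case=> _; apply].
move=> /nbhs_ballP[e /= e0 eV]; exists e => // x xe Vx.
by apply: contrapT => xp; apply: (eV x) => //; rewrite ballEmdist.
Qed.

(** The change of parameter from [h] to [g] is an isometry between subsets of the line, since both
    are isometric for the same path metric. *)
Lemma interval_isometry_affine (A : set T) l g (D : set R) h : interval_isometry A l g ->
  D 0 -> (forall t, D t -> 0 <= t) -> (forall t, D t -> A (h t)) ->
  (forall s t, D s -> D t -> path_dist A (h s) (h t) = `|s - t|%:E) ->
  exists c d, forall t, D t -> `[0, l]%classic (c + d * t) /\ h t = g (c + d * t).
Proof.
move=> [l0 gA giso] D0 Dge0 DA hiso.
have /choice[u uP] t : exists u, D t -> `[0, l]%classic u /\ h t = g u.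
  have [Dt|nDt] := pselect (D t); last by exists 0.
  by have := DA t Dt; rewrite -gA => -[u lu <-]; exists u.
have [||s t Ds Dt|d ud] := @isometry_affine R D u; [by []|by []| |].
  have [[ls hs] [lt ht]] := (uP s Ds, uP t Dt).
  by have := hiso s t Ds Dt; rewrite hs ht giso// => -[].
by exists (u 0), d => t Dt; rewrite -ud//; exact: uP.
Qed.

(** For small positive times a geodesic avoids the finite set [V], so it runs in a single component,
    whose closure also contains [p]. There [f] is affine in one parametrization, and the geodesic is
    an affine reparametrization of it. *)
Lemma PL_germ_affine f : PL f -> germ_affine f.
Proof.
move=> [_ [V [finV _ edgeV] fV]] p g [g0 [eps eps0 iso]].
have [e1 e10 e1V] := finite_set_avoid p finV.
pose e := Num.min eps e1.
have e0 : 0 < e by rewrite lt_min eps0.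
have eeps : e <= eps by rewrite ge_min lexx.
have ee1 : e <= e1 by rewrite ge_min lexx orbT.
clearbody e.
have {}iso : isometric_on `[0, e[ g.
  by move=> s t; rewrite /= !in_itv/= => s0 t0; apply: iso; lra.
have gp t : 0 <= t < e -> mdist p (g t) = t.
  move=> t0; rewrite -g0 iso ?in_itv//=; first by rewrite sub0r normrN ger0_norm//; lra.
  by rewrite in_itv/= lexx.
pose C := connected_component (~` V) (g (e / 2)).
have GC : g @` `]0, e[ `<=` C.
  apply: connected_component_max.
  - by exists (e / 2) => //=; rewrite in_itv/=; lra.
  - move=> y [t /=]; rewrite in_itv/= => te <- Vg.
    have te' : 0 <= t < e by lra.
    have gtp : g t = p by apply: e1V => //; rewrite gp//; lra.
    by have := gp t te'; rewrite gtp mdistxx; lra.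
  - apply: connected_continuous_connected; first exact/connected_intervalP/interval_is_interval.
    apply: isometric_continuous => s t /=; rewrite !in_itv/= => s0 t0.
    by apply: iso; rewrite /= in_itv/=; lra.
have compC : component_of (~` V) C.
  exists (g (e / 2)) => //; apply: (@connected_component_sub _ _ (g (e / 2))).
  by apply: GC; exists (e / 2) => //=; rewrite in_itv/=; lra.
have clC t : 0 <= t < e -> closure C (g t).
  move=> te; have [t0|t0] := eqVneq t 0; last first.
    apply: subset_closure; apply: GC; exists t => //=; rewrite in_itv/=.
    by rewrite lt_def t0.
  rewrite t0 g0 => B /nbhs_ballP[d /= d0 dB].
  have m0 : 0 < Num.min d e by rewrite lt_min d0.
  have [md me] : Num.min d e <= d /\ Num.min d e <= e.
    by rewrite !ge_min !lexx orbT.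
  exists (g (Num.min d e / 2)); split.
    by apply: GC; exists (Num.min d e / 2) => //=; rewrite in_itv/=; lra.
  by apply: dB; rewrite ballEmdist/= gp; lra.
have [l [g' g'iso]] := edgeV _ compC.
have [a [b fg']] := fV _ compC _ _ g'iso.
have [||t|s t|c [d gE]] := @interval_isometry_affine _ _ _ `[0, e[ g g'iso.
- by rewrite /= in_itv/= lexx.
- by move=> t; rewrite /= in_itv/= => /andP[].
- by rewrite /= in_itv/=; exact: clC.
- rewrite /= !in_itv/= => s0 t0.
  (* The geodesic is controlled on a half-open interval, while path distances are computed on a
     closed one that contains both times. *)
  have [m [sm tm me]] : exists m, [/\ s <= m, t <= m & m < e].
    by exists (Num.max s t); rewrite !le_max !lexx orbT gt_max; split=> //; lra.
  apply: (@path_dist_isometric _ _ _ _ 0 m); [| |lra|lra].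
    by move=> u v /=; rewrite !in_itv/= => u0 v0; apply: iso; rewrite /= in_itv/=; lra.
  by move=> y [u /=]; rewrite in_itv/= => u0 <-; apply: clC; lra.
exists (b * d), e => // t te.
have [lt gt] := gE t te.
have [l0 gl0] := gE 0 ltac:(by rewrite /= in_itv/= lexx).
rewrite -g0 gl0 gt !fg'//; ring.
Qed.

End PLGerms.

(** * Vertex sets *)

Section ComponentArcs.
Context {R : realType} {T : metricType R}.
Implicit Types (p x : T) (f : T -> R) (V C W : set T) (g : R -> T).

Lemma mdist_continuous x : continuous (mdist x).
Proof.
move=> y; apply/cvgrPdist_lt => e e0; apply/nbhs_ballP; exists e => // z.
rewrite ballEmdist/= => yz; apply: le_lt_trans yz.
rewrite ler_norml; apply/andP; split.
  by have := metric_triangle x y z; lra.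
by have := metric_triangle x z y; rewrite (metric_sym z y); lra.
Qed.

Lemma isometric_compact a b g : isometric_on `[a, b] g -> compact (g @` `[a, b]).
Proof.
move=> iso; apply: continuous_compact; last exact: segment_compact.
exact: isometric_continuous.
Qed.

Lemma isometric_closed a b g : isometric_on `[a, b] g -> closed (g @` `[a, b]).
Proof.
by move=> iso; apply: compact_closed; [exact: metric_hausdorff|exact: isometric_compact].
Qed.

(** The distance to [g a] is a coordinate on the arc. It attains its bounds on the compact closure
    of the component, and connectedness fills the interval between them. *)
Lemma closure_component_arc V x a b t g : finite_set V -> ~ V x ->
  isometric_on `[a, b] g -> a < t < b -> x = g t ->
  connected_component (~` V) x `<=` g @` `[a, b] ->
  exists a' b', [/\ a <= a', a' < b', b' <= b &
    closure (connected_component (~` V) x) = g @` `[a', b']].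
Proof.
move=> finV Vx iso tab xE; set C := connected_component _ _ => CS.
have clC : closure C `<=` g @` `[a, b].
  rewrite [X in _ `<=` X](closure_id _).1; last exact: isometric_closed.
  exact: closure_subset.
have cC : compact (closure C).
  exact: subclosed_compact (@closed_closure _ C) (isometric_compact iso) clC.
have Cx : C x by exact: connected_component_refl.
have psiE u : a <= u <= b -> mdist (g a) (g u) = u - a.
  move=> au; rewrite iso; [|rewrite /= in_itv/=; lra..].
  by rewrite distrC ger0_norm//; lra.
have ctpsi : {within closure C, continuous (mdist (g a))}.
  by apply: continuous_subspaceT => y; exact: mdist_continuous.
have [|y1 + y1max] := compact_EVT_max _ cC ctpsi; first by exists x; exact: subset_closure.
rewrite inE => Cy1; have [|y0 + y0min] := compact_EVT_min _ cC ctpsi.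
  by exists x; exact: subset_closure.
rewrite inE => Cy0.
have [b' /= + b'E] := clC _ Cy1; rewrite in_itv/= => b'ab.
have [a' /= + a'E] := clC _ Cy0; rewrite in_itv/= => a'ab.
have itvC u : a <= u <= b -> closure C (g u) -> a' <= u <= b'.
  move=> uab Cu; have := y1max (g u); have := y0min (g u).
  rewrite !inE -a'E -b'E !psiE// => /(_ Cu) + /(_ Cu); lra.
(* A second point of the component beyond [x] rules out a degenerate sub-arc. *)
have [u [uab ut Cu]] : exists u, [/\ a <= u <= b, t < u & C (g u)].
  have [e e0 eV] := finite_set_avoid x finV.
  have m0 : 0 < Num.min e (b - t) by rewrite lt_min e0; lra.
  have [me mb] : Num.min e (b - t) <= e /\ Num.min e (b - t) <= b - t.
    by rewrite !ge_min !lexx orbT.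
  exists (t + Num.min e (b - t) / 2); split; [lra|lra|].
  suff : g @` `[t, t + Num.min e (b - t) / 2] `<=` C.
    by apply; exists (t + Num.min e (b - t) / 2) => //=; rewrite in_itv/=; lra.
  apply: connected_component_max.
  - by exists t => //=; rewrite in_itv/=; lra.
  - move=> y [u /=]; rewrite in_itv/= => ut <- Vu; apply: Vx.
    rewrite (_ : x = g u)//; apply/esym/eV => //.
    rewrite xE iso; [|rewrite /= in_itv/=; lra..].
    by rewrite distrC ger0_norm; lra.
  - apply: connected_continuous_connected; first exact/connected_intervalP/interval_is_interval.
    by apply: isometric_continuous => v w /=; rewrite !in_itv/= => v0 w0;
      apply: iso; rewrite /= in_itv/=; lra.
exists a', b'; split; [lra| |lra|].
- have := itvC u uab (subset_closure Cu).
  have := itvC t ltac:(lra) ltac:(by rewrite -xE; exact: subset_closure); lra.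
- apply/seteqP; split=> [y Cy|_ [v /= + <-]].
    have [v /= + vE] := clC y Cy; rewrite in_itv/= => vab.
    by exists v => //=; rewrite in_itv/=; apply: itvC => //; rewrite vE.
  rewrite in_itv/= => vab.
  have /connected_intervalP itvJ : connected (mdist (g a) @` closure C).
    apply: connected_continuous_connected ctpsi.
    exact/connected_closure/component_connected.
  have [|||y Cy] := itvJ (a' - a) (b' - a) _ _ (v - a); [| |lra|].
  - by exists y0 => //; rewrite -a'E psiE.
  - by exists y1 => //; rewrite -b'E psiE.
  have [w /= + wE] := clC y Cy; rewrite in_itv/= => wab.
  by rewrite -wE psiE// => /addIr <-; rewrite wE.
Qed.

Lemma chart_branch_open (K : finType) p r (phi : K -> R -> T) k r' :
  star_chart p r phi -> r' <= r -> open (phi k @` `]0, r'[).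
Proof.
move=> chart r'r; rewrite openE => _ [t /= + <-]; rewrite in_itv/= => t0.
have r'0 : 0 < r' <= r by lra.
have [m0 _ cov _ _] := interior_chart k (chart_shrink chart r'0) t0.
apply/nbhs_ballP; exists (Num.min t (r' - t)) => // y; rewrite ballEmdist/=.
move=> /cov[->|[b [s [/andP[s0]]]]]; first by exists t => //=; rewrite in_itv.
rewrite lt_min => /andP[st sr] ->; exists (if b then t + s else t - s) => //=.
by rewrite in_itv/=; case: b; lra.
Qed.

Lemma interior_not_branch (K : finType) p r (phi : K -> R -> T) k t :
  star_chart p r phi -> 0 < t < r -> ~ branch_point (phi k t).
Proof.
move=> chart t0; apply; have chart' := interior_chart k chart t0.
rewrite (chart_tangents chart'); set h := fun b : bool => _.
have -> : range h = (fun n => h (n == 0%N)) @` `I_2.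
  apply/seteqP; split=> _ [b _ <-]; last by exists (b == 0%N).
  by case: b; [exists 0%N|exists 1%N].
apply: inj_card_eq => m n; rewrite !inE/= => m2 n2 /(chart_germ_inj chart').
by case: m m2 => [|[|]]//; case: n n2 => [|[|]].
Qed.

End ComponentArcs.

Section AffineArcs.
Context {R : realType} {T : metricType R}.
Implicit Types (p x : T) (f : T -> R) (V C W : set T) (g : R -> T).
Hypotheses (charts : @has_star_charts R T).

(** The last clause confines the component of [x] off [W] to the arc. Stated for all connected sets,
    it visibly survives an enlargement of [W], as gluing finitely many local choices requires. *)
Definition affine_arc f W x := exists g a b t, [/\ isometric_on `[a, b] g,
  a < t < b, x = g t,
  exists c d, forall s, a <= s <= b -> f (g s) = c + d * s &
  forall B, connected B -> B x -> B `<=` ~` W -> B `<=` g @` `[a, b]].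

(** [W] consists of the center of a small star and of one point on each branch, so that every other
    point near [p] is on an open segment with both ends in [W]. *)
Lemma affine_arc_nbhs f p : germ_affine f -> exists2 W, finite_set W &
  nbhs p [set x | W x \/ affine_arc f W x /\ ~ branch_point x].
Proof.
move=> af; have [K [r0 [phi chart0]]] := charts p.
have [r rP [b fE]] := affine_chart chart0 af.
have chart := chart_shrink chart0 rP; have [r_gt0 phi0 cov dphi _] := chart.
exists ([set p] `|` range (fun k => phi k (r / 2))).
  by rewrite finite_setU; split; [exact: finite_set1|exact: finite_image].
apply/nbhs_ballP; exists (r / 2) => /=; first by rewrite divr_gt0.
move=> x; rewrite ballEmdist/= => xr.
have [->|[k [t [t0 xE]]]] := cov x ltac:(lra); first by left; left.
have tr : t < r / 2 by move: xr; rewrite xE (chart_dist chart)//; lra.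
right; split; last by rewrite xE; exact: (interior_not_branch chart t0).
have iso : isometric_on `[0, r / 2] (phi k).
  by move=> u v /=; rewrite !in_itv/= => u0 v0; apply: dphi; lra.
exists (phi k), 0, (r / 2), t; split=> //; first by lra.
  by exists (f p), (b k) => s s0; apply: fE; lra.
move=> B cB Bx BW.
(* The open segment is open in the space, and inside [B] it is also closed, since [B] avoids its two
   ends. *)
suff <- : B `&` (phi k @` `]0, r / 2[) = B.
  by move=> _ [_ [s /= s0 <-]]; exists s => //=; move: s0; rewrite !in_itv/=; lra.
apply: cB.
- by exists x; split=> //; exists t => //=; rewrite in_itv/=; lra.
- exists (phi k @` `]0, r / 2[) => //; apply: (chart_branch_open k chart); lra.
exists (phi k @` `[0, r / 2]); first exact: isometric_closed.
apply/seteqP; split=> y [By [s /= + sE]]; rewrite in_itv/= => s0.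
  by split=> //; exists s => //=; rewrite in_itv/=; lra.
split=> //; exists s => //=; rewrite in_itv/=.
have [ss|ss] := eqVneq s 0.
  by exfalso; apply: (BW y By); left; rewrite -sE ss phi0.
have [sr|sr] := eqVneq s (r / 2).
  by exfalso; apply: (BW y By); right; exists k => //; rewrite -sr.
by rewrite !lt_neqAle eq_sym ss sr.
Qed.

Hypotheses (cT : compact [set: T]).

Lemma germ_affine_PL f : germ_affine f -> PL f.
Proof.
move=> af; split; first exact: germ_affine_continuous.
(* Compactness is used along the filter of the finite sets of vertices, ordered by
   inclusion. *)
pose F := filter_from (@finite_set T) (fun W => [set V | W `<=` V]).
have FF : Filter F.
  apply: filter_from_filter; first by exists set0; exact: finite_set0.
  move=> V W finV finW; exists (V `|` W); first by rewrite finite_setU.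
  by move=> U VWU; split=> x; [move=> Vx; apply: VWU; left|move=> Wx; apply: VWU; right].
have [V finV arcV] : F [set V | [set: T] `<=`
    [set x | V x \/ affine_arc f V x /\ ~ branch_point x]].
  apply: ((compact_near_coveringP [set: T]).1 cT _ F
    (fun V x => V x \/ affine_arc f V x /\ ~ branch_point x) FF) => p _.
  have [W finW Np] := affine_arc_nbhs p af.
  exists ([set x | W x \/ affine_arc f W x /\ ~ branch_point x], [set V | W `<=` V]).
    by split=> //; exists W.
  move=> [x V] [/= [Wx|[[g [a [b [t [iso tab xE aff Bsub]]]]] nb]] WV].
    by left; exact: WV.
  right; split=> //; exists g, a, b, t; split=> // B cB Bx BV.
  by apply: Bsub => // y /BV Vy /WV.
have {}arcV x : ~ V x -> affine_arc f V x /\ ~ branch_point x.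
  by move=> Vx; have [|] := arcV V (@subset_refl _ V) x I.
have comp C : component_of (~` V) C -> exists g a b,
    interval_isometry (closure C) (b - a) (fun s => g (a + s)) /\
    exists c d, forall s, a <= s <= b -> f (g s) = c + d * s.
  move=> [x Vx ->]; have [[g [a [b [t [iso tab xE [c [d aff]] Bsub]]]]] _] := arcV x Vx.
  have [|a' [b' [aa' ab' bb' clE]]] := closure_component_arc finV Vx iso tab xE.
    apply: Bsub; [exact: component_connected|exact: connected_component_refl|].
    exact: connected_component_sub.
  exists g, a', b'; split; last by exists c, d => s s0; apply: aff; lra.
  split; first by rewrite subr_gt0.
    rewrite clE; apply/seteqP; split=> _ [s /= + <-]; rewrite in_itv/= => s0.
      by exists (a' + s) => //=; rewrite in_itv/=; lra.
    by exists (s - a'); [rewrite /= in_itv/=; lra|congr g; ring].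
  move=> s u /=; rewrite !in_itv/= => s0 u0.
  rewrite (@path_dist_isometric _ _ _ _ a' b'); [| |by rewrite clE|lra|lra].
    by congr (`|_|%:E); ring.
  by move=> v w /=; rewrite !in_itv/= => v0 w0; apply: iso; rewrite /= in_itv/=; lra.
exists V; first split=> //.
- by move=> x bx; apply: contrapT => /arcV[].
- by move=> C /comp[g [a [b [giso _]]]]; exists (b - a), (fun s => g (a + s)).
(* [PL] asks for affinity in every parametrization of the edge; an arbitrary [h] is compared with
   the constructed one. *)
move=> C /comp[g [a [b [giso [c [d aff]]]]]] l h [l0 hC hiso].
have [||t lt||c' [d' hE]] := @interval_isometry_affine _ _ _ _ _ `[0, l] h giso.
- by rewrite /= in_itv/= lexx ltW.
- by move=> t; rewrite /= in_itv/= => /andP[].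
- by rewrite -hC; exists t.
- exact: hiso.
exists (c + d * a + d * c'), (d * d') => t lt; have [+ ->] := hE t lt.
by rewrite /= in_itv/= => t0; rewrite aff; [ring|lra].
Qed.
End AffineArcs.

(** * The functions j *)

Section JFunction.
Context {R : realType} {T : metricType R}.
Implicit Types (p q x y z a b : T) (f g : T -> R).

Lemma indic_set1 p q : \1_[set p] q = (q == p)%:R :> R.
Proof.
by rewrite indicE; congr ((_ : bool)%:R); apply/idP/eqP; rewrite inE.
Qed.

(** The indicator reduces the support of the sum to [p], so [sigma] is recovered for any [f], even
    one whose [sigma] has infinite support. *)
Lemma Laplacian_set1 f p : Laplacian f [set p] = sigma f p.
Proof.
rewrite /Laplacian -(@fsbig_widen _ _ _ _ [set p])//.
  by rewrite fsbig_set1 indic_set1 eqxx mulr1.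
by move=> q /= [_ qp]; rewrite indic_set1; move/eqP/negPf : qp => ->; rewrite mulr0.
Qed.

Lemma Laplacian_dirac f a b : sigma f = dirac_diff a b ->
  Laplacian f = (fun A => \1_A a - \1_A b).
Proof.
move=> sf; apply/funext => A; rewrite /Laplacian sf.
have [->|ab] := eqVneq a b.
  by rewrite subrr fsbig1// => q _; rewrite /dirac_diff subrr mul0r.
rewrite -(@fsbig_widen _ _ _ _ ([set a] `|` [set b]))//; last first.
  move=> q /= [_ /not_orP[qa qb]]; rewrite /dirac_diff.
  by move/eqP/negPf : qa => ->; move/eqP/negPf : qb => ->; rewrite subrr mul0r.
rewrite fsbigU0//=; last by move=> q /= [-> /eqP]; rewrite (negPf ab).
by rewrite !fsbig_set1 /dirac_diff !eqxx [b == a]eq_sym (negPf ab) subr0 sub0r mul1r mulN1r.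
Qed.

(** The common setting of a metric graph and of its collapse, the latter being possibly a single
    point. *)
Definition network := [/\ @has_star_charts R T, compact [set: T] & connected [set: T]].

Hypothesis net : network.

Let charts : @has_star_charts R T. Proof. by case: net. Qed.
Let cT : compact [set: T]. Proof. by case: net. Qed.
Let conT : connected [set: T]. Proof. by case: net. Qed.

(** The choice behind [jfun] is determined: any other candidate in [PL] is affine along germs with
    the same [sigma], hence differs from [f] by a constant, fixed by its value at [z]. *)
Lemma jfun_set1 f y z : germ_affine f -> sigma f = dirac_diff y z ->
  (fun x => jfun z x y) = (fun x => f x - f z).
Proof.
move=> af sf; rewrite /jfun.
set S := (S in xget _ S).
suff -> : xget (fun=> 0) S = (fun x => f x - f z) by [].
have afz : germ_affine (fun x => f x - f z).
  have := germ_affine_lin 1 af (germ_affine_cst (- f z)).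
  by congr germ_affine; apply/funext => x; rewrite mul1r.
have sfz : sigma (fun x => f x - f z) = dirac_diff y z.
  apply/funext => q; rewrite -sf.
  have := sigma_lin charts 1 q af (germ_affine_cst (- f z)).
  by rewrite sigma_cst// addr0 mul1r => <-; congr (sigma _ q); apply/funext => x; rewrite mul1r.
apply: xget_unique.
  split; [exact: germ_affine_PL|exact: Laplacian_dirac|by rewrite subrr].
move=> g [/PL_germ_affine ag Lg gz]; apply/funext => x.
have sg : sigma g = sigma f.
  apply/funext => q; rewrite -[LHS]Laplacian_set1 Lg sf /dirac_diff !indic_set1.
  by rewrite ![_ == q]eq_sym.
by rewrite -(sigma_inj charts cT conT ag af sg x z) gz subr0.
Qed.

Lemma potential_exists y z : exists2 u : T -> R, germ_affine u & sigma u = dirac_diff y z.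
Proof.
(* The zero function is a potential for the trivial pair [z], [z]; only the existence part of the
   duality is used. *)
have [||u [au su _]] := @dual_potential _ _ charts cT conT (fun=> 0) z z y z.
- exact: germ_affine_cst.
- by apply/funext => q; rewrite sigma_cst// /dirac_diff subrr.
by exists u.
Qed.

Lemma jfun_affine z y : germ_affine (fun x => jfun z x y).
Proof.
have [u au su] := potential_exists y z; rewrite (jfun_set1 au su).
have := germ_affine_lin 1 au (germ_affine_cst (- u z)).
by congr germ_affine; apply/funext => x; rewrite mul1r.
Qed.

Lemma sigma_jfun z y : sigma (fun x => jfun z x y) = dirac_diff y z.
Proof.
have [u au su] := potential_exists y z; rewrite (jfun_set1 au su) -su.
apply/funext => q; have := sigma_lin charts 1 q au (germ_affine_cst (- u z)).
by rewrite sigma_cst// addr0 mul1r => <-; congr (sigma _ q); apply/funext => x; rewrite mul1r.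
Qed.

Lemma jfunE f x y z : germ_affine f -> sigma f = dirac_diff y z ->
  jfun z x y = f x - f z.
Proof. by move=> af sf; have /(congr1 (@^~ x)) := jfun_set1 af sf. Qed.

Lemma jfun_base z y : jfun z z y = 0.
Proof. by rewrite (jfunE z (jfun_affine z y) (sigma_jfun z y)) subrr. Qed.

(** Duality yields some potential of the pair [a], [b] with the required difference; [g] equals it
    up to a constant. *)
Lemma reciprocity f g x y a b : germ_affine f -> germ_affine g ->
  sigma f = dirac_diff x y -> sigma g = dirac_diff a b -> g x - g y = f a - f b.
Proof.
move=> af ag sf sg; have [u [au su <-]] := dual_potential charts cT conT a b af sf.
by apply: sigma_inj => //; rewrite su.
Qed.

End JFunction.

(** * Collapsing an edge segment *)

Section EdgeEnds.
Context {R : realType} {T : metricType R}.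
Implicit Types (p x y : T) (A V C : set T) (g : R -> T).

Lemma metric_graph_network : metric_graph T -> @network R T.
Proof.
move=> [cT conT _ stars _]; split=> // p.
have [n [r [phi [_ r0 phi0 /nbhs_ballP[d /= d0 dphi] phid]]]] := stars p.
(* The star is only known to cover some ball around [p], whereas a chart must cover the ball of its
   own radius. *)
pose r' := Num.min r d.
have r'0 : 0 < r' by rewrite lt_min r0.
have [r'r r'd] : r' <= r /\ r' <= d by rewrite !ge_min !lexx orbT.
exists 'I_n, r', (fun k t => phi (k, t)); split=> //.
- move=> x xr'; have [[k t]] : (phi @` @star R n r) x.
    by apply: dphi; rewrite ballEmdist/=; lra.
  rewrite /star/= => tr xE; have [t0|t0] := eqVneq t 0.
    by left; rewrite -xE t0 phi0.
  right; exists k, t; split=> //; move: xr'; rewrite -xE -(phi0 k).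
  rewrite phid ?/star/= ?lexx// /star_dist/= eqxx sub0r normrN ger0_norm; last by lra.
  by move=> tr'; rewrite tr' lt_def t0; lra.
- by move=> k s t s0 t0; rewrite phid ?/star/=; [rewrite /star_dist/= eqxx|lra|lra].
- move=> j k s t /negPf jk s0 t0.
  by rewrite phid ?/star/=; [rewrite /star_dist/= jk|lra|lra].
Qed.

Section Interval.
Variables (A : set T) (l : R) (g : R -> T).
Hypothesis giso : interval_isometry A l g.

Let l0 : 0 < l. Proof. by case: giso. Qed.

Lemma interval_isometry_sub s : 0 <= s <= l -> A (g s).
Proof. by case: giso => _ <- _ sl; exists s. Qed.

Lemma interval_isometry_inj s t : 0 <= s <= l -> 0 <= t <= l -> g s = g t -> s = t.
Proof.
case: giso => _ _ iso sl tl st.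
have := iso s t ltac:(by []) ltac:(by []); rewrite -st iso// subrr normr0 => -[].
by move/esym/eqP; rewrite normr_eq0 subr_eq0 => /eqP.
Qed.

(** Equality may fail: the ends of a long edge can be joined by a shorter path outside it. *)
Lemma interval_isometry_dist s t : 0 <= s <= l -> 0 <= t <= l ->
  mdist (g s) (g t) <= `|s - t|.
Proof.
case: giso => _ _ iso sl tl; rewrite -lee_fin -iso//.
exact: mdist_le_path_dist.
Qed.

Lemma interval_isometry_continuous a b : 0 <= a -> b <= l ->
  {within `[a, b], continuous g}.
Proof.
move=> a0 bl; apply: nonexpansive_continuous => s t /=; rewrite !in_itv/= => s0 t0.
by apply: interval_isometry_dist; lra.
Qed.

Lemma interval_isometry_closed a b : 0 <= a -> b <= l -> closed (g @` `[a, b]).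
Proof.
move=> a0 bl; apply: compact_closed; first exact: metric_hausdorff.
apply: continuous_compact; last exact: segment_compact.
exact: interval_isometry_continuous.
Qed.

Lemma interval_isometry_rev : interval_isometry A l (fun t => g (l - t)).
Proof.
case: giso => _ gA iso; split=> //.
  rewrite -gA; apply/seteqP; split=> _ [t /= + <-]; rewrite in_itv/= => tl.
    by exists (l - t) => //=; rewrite in_itv/=; lra.
  by exists (l - t); [rewrite /= in_itv/=; lra|congr g; ring].
move=> s t /=; rewrite !in_itv/= => sl tl; rewrite iso ?/=; last 2 first.
- by rewrite in_itv/=; lra.
- by rewrite in_itv/=; lra.
by rewrite distrC; congr (`|_|%:E); ring.
Qed.

(** A nearby point [g t1] selects a branch [k0], which [g] must fill up to that point by
    connectedness. Both being isometric for the path metric of [A], they coincide there; the rest of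
    [A] is closed, misses [g 0], and is excluded by shrinking the radius. *)
Lemma interval_end_chart : @has_star_charts R T ->
  exists (K : finType) r (phi : K -> R -> T) k0, [/\ star_chart (g 0) r phi,
    forall t, 0 <= t < r -> A (phi k0 t) &
    forall k t, k != k0 -> 0 < t < r -> ~ A (phi k t)].
Proof.
move=> charts; have [K [r0 [phi chart]]] := charts (g 0).
have [r0_gt0 phi0 cov dphi _] := chart; have [_ gA iso] := giso.
have m0 : 0 < Num.min l r0 by rewrite lt_min l0.
have [ml mr] : Num.min l r0 <= l /\ Num.min l r0 <= r0 by rewrite !ge_min !lexx orbT.
pose t1 := Num.min l r0 / 2.
have [t10 t1l t1r] : [/\ 0 < t1, t1 <= l & t1 < r0] by rewrite /t1; split; lra.
clearbody t1.
have gd t : 0 <= t <= t1 -> mdist (g 0) (g t) <= t.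
  move=> tt1; have := @interval_isometry_dist 0 t ltac:(lra) ltac:(lra).
  by rewrite sub0r normrN ger0_norm; lra.
have [k0 [u1 [u1r gt1]]] : exists k0 u1, 0 < u1 < r0 /\ g t1 = phi k0 u1.
  have [|g01|[k0 [u1 H]]] := cov (g t1); last by exists k0, u1.
    by have := gd t1 ltac:(lra); lra.
  by have := @interval_isometry_inj t1 0 ltac:(lra) ltac:(lra) g01; lra.
have branchA u : 0 <= u <= u1 -> A (phi k0 u).
  have [->|un0] := eqVneq u 0.
    by rewrite phi0 => _; apply: interval_isometry_sub; lra.
  have [->|unu1] := eqVneq u u1.
    by rewrite -gt1 => _; apply: interval_isometry_sub; lra.
  (* g runs in the star from its center to phi k0 u1, hence through phi k0 u. *)
  move=> uu1; apply: contrapT => nA.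
  have iso0 a b : 0 <= a -> b < r0 -> isometric_on `[a, b] (phi k0).
    by move=> a0 b0 v w /=; rewrite !in_itv/= => v0 w0; apply: dphi; lra.
  pose G := g @` `[0, t1].
  have cG : connected G.
    apply: connected_continuous_connected; first exact/connected_intervalP/interval_is_interval.
    by apply: interval_isometry_continuous.
  pose O := phi k0 @` `]0, r0[ `&` ~` (phi k0 @` `[0, u]).
  have GO : G `&` O = G.
    apply: cG.
    - exists (g t1); split; first by exists t1 => //=; rewrite in_itv/=; lra.
      rewrite gt1; split; first by exists u1 => //=; rewrite in_itv/=; lra.
      move=> [v /= + vE]; rewrite in_itv/= => v0.
      have [] := @chart_inj _ _ _ _ _ _ chart k0 k0 u1 v ltac:(lra) ltac:(lra) ltac:(by []).
      by lra.
    - exists O => //; apply: openI.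
        exact: (chart_branch_open _ chart).
      by apply: closed_openC; apply: isometric_closed; apply: iso0; lra.
    (* All of [G] is within [t1] of the center, so this closed segment captures the part of [G]
       beyond [u]; the point at [u] itself is off [A]. *)
    - exists (phi k0 @` `[u, t1]).
        by apply: isometric_closed; apply: iso0; lra.
      apply/seteqP; split=> y [Gy].
        move=> [[v /= + vE] nv]; rewrite in_itv/= => v0; split=> //.
        exists v => //=; rewrite in_itv/=; apply/andP; split.
          rewrite leNgt; apply/negP => vu; apply: nv; exists v => //=.
          by rewrite in_itv/=; lra.
        move: Gy => [t /= + tE]; rewrite in_itv/= => tt1.
        have := gd t ltac:(lra); rewrite tE -vE (chart_dist chart); lra.
      move=> [v /= + vE]; rewrite in_itv/= => v0; split=> //; split.
        by exists v => //=; rewrite in_itv/=; lra.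
      move=> [w /= + wE]; rewrite in_itv/= => w0.
      have [_ vw] := @chart_inj _ _ _ _ _ _ chart k0 k0 v w ltac:(lra) ltac:(lra)
        ltac:(by rewrite wE).
      apply: nA; rewrite (_ : u = v); last by lra.
      by rewrite vE; case: Gy => t /= + <-; rewrite in_itv/= => tt1;
        apply: interval_isometry_sub; lra.
  have : G (g 0) by exists 0 => //=; rewrite in_itv/=; lra.
  rewrite -GO => -[_ [[v /= + vE] _]]; rewrite in_itv/= => v0.
  by have := @chart_dist _ _ _ _ _ _ chart k0 v ltac:(lra); rewrite vE mdistxx; lra.
have pd s t : 0 <= s <= u1 -> 0 <= t <= u1 ->
    path_dist A (phi k0 s) (phi k0 t) = `|s - t|%:E.
  apply: path_dist_isometric.
    by move=> v w /=; rewrite !in_itv/= => v0 w0; apply: dphi; lra.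
  by move=> y [v /= + <-]; rewrite in_itv/=; exact: branchA.
have [||t|s t|c [d gE]] := @interval_isometry_affine _ _ _ _ _ `[0, u1] (phi k0) giso.
- by rewrite /= in_itv/=; lra.
- by move=> t; rewrite /= in_itv/= => /andP[].
- by rewrite /= in_itv/=; exact: branchA.
- by rewrite /= !in_itv/=; exact: pd.
(* The change of parameter is the identity: both curves start at [g 0], and both parameters are
   nonnegative and measure the path distance from it. *)
have c0 : c = 0.
  have [+ ] := gE 0 ltac:(by rewrite /= in_itv/=; lra).
  rewrite mulr0 addr0 phi0 /= in_itv/= => cl /interval_isometry_inj -> //; lra.
have d1 : d = 1.
  have [/= + guE] := gE u1 ltac:(by rewrite /= in_itv/=; lra).
  rewrite c0 add0r in_itv/= in guE * => dl.
  have := pd 0 u1 ltac:(lra) ltac:(lra).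
  rewrite phi0 guE iso ?/=; [|rewrite in_itv/=; lra..].
  rewrite !sub0r !normrN !ger0_norm; [|lra..] => -[] du1.
  have u1n : u1 != 0 by rewrite gt_eqF//; lra.
  by apply: (mulIf u1n); rewrite mul1r.
have phig t : 0 <= t <= u1 -> t <= l /\ phi k0 t = g t.
  move=> tu1; have [] := gE t ltac:(by rewrite /= in_itv/=).
  by rewrite c0 d1 add0r mul1r /= in_itv/= => /andP[].
have [u1l _] := phig u1 ltac:(lra).
(* The edge could return close to its end in the ambient metric; compactness keeps this remaining
   part at a positive distance. *)
have clg : closed (g @` `[u1, l]) by apply: interval_isometry_closed; lra.
have : nbhs (g 0) (~` (g @` `[u1, l])).
  apply: open_nbhs_nbhs; split; first exact: closed_openC.
  move=> [t /= + t0]; rewrite in_itv/= => tl.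
  by have := @interval_isometry_inj t 0 ltac:(lra) ltac:(lra) t0; lra.
move=> /nbhs_ballP[e /= e0 dg].
have rP : 0 < Num.min u1 e <= r0.
  by rewrite lt_min e0 ge_min; apply/andP; split; [|apply/orP; left]; lra.
have [mu md] : Num.min u1 e <= u1 /\ Num.min u1 e <= e by rewrite !ge_min !lexx orbT.
exists K, (Num.min u1 e), phi, k0; split; first exact: (chart_shrink chart rP).
  by move=> t t0; apply: branchA; lra.
move=> k t kk0 t0; rewrite -gA => -[s /= + sE]; rewrite in_itv/= => sl.
have [su|su] := ltP s u1.
  have [_ sg] := phig s ltac:(lra); rewrite -sg in sE.
  have [kE _] := @chart_inj _ _ _ _ _ _ chart k k0 t s ltac:(lra) ltac:(lra) ltac:(by []).
  by rewrite kE eqxx in kk0.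
apply: (dg (phi k t)); first by rewrite ballEmdist/= (chart_dist chart); lra.
by exists s => //=; rewrite in_itv/= su; lra.
Qed.

End Interval.
End EdgeEnds.

(** * Openness of the interior of an edge *)

Section EdgeInterior.
Context {R : realType} {T : metricType R}.
Implicit Types (p x y : T) (A V C : set T) (g : R -> T).
Hypothesis charts : @has_star_charts R T.

Lemma component_open V x : finite_set V -> open (connected_component (~` V) x).
Proof.
move=> finV; rewrite openE => p Cp.
have Vp : ~ V p by exact: connected_component_sub Cp.
have [K [r0 [phi chart0]]] := charts p.
have [e e0 eV] := finite_set_avoid p finV.
pose r := Num.min r0 e.
have [r0_gt0 _ _ _ _] := chart0.
have rP : 0 < r <= r0 by rewrite lt_min e0 r0_gt0 ge_min lexx.
have re : r <= e by rewrite ge_min lexx orbT.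
have [r_gt0 phi0 cov dphi _] := chart_shrink chart0 rP.
apply/nbhs_ballP; exists r => //= y; rewrite ballEmdist/= => /cov[->//|[k [t [t0 yE]]]].
have : phi k @` `[0, t] `<=` connected_component (~` V) p.
  apply: connected_component_max.
  - by exists 0; rewrite ?phi0//= in_itv/=; lra.
  - move=> z [s /=]; rewrite in_itv/= => st <- Vs; apply: Vp.
    rewrite -(eV (phi k s))//; rewrite -(phi0 k) dphi; [|lra..].
    by rewrite sub0r normrN ger0_norm; lra.
  - apply: connected_continuous_connected; first exact/connected_intervalP/interval_is_interval.
    by apply: isometric_continuous => v w /=; rewrite !in_itv/= => v0 w0; apply: dphi; lra.
rewrite -(same_connected_component Cp); apply; exists t => //=.
by rewrite in_itv/=; lra.
Qed.

(** Points strictly inside the parametrization belong to [C] itself, which is open; the closure adds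
    at most the two ends. *)
Lemma interval_interior_nbhs V C l g t : finite_set V -> component_of (~` V) C ->
  interval_isometry (closure C) l g -> 0 < t < l -> nbhs (g t) (closure C).
Proof.
move=> finV [x Vx CE] giso tl.
have [Cg|nCg] := pselect (C (g t)).
  have oC : open C by rewrite CE; exact: component_open.
  apply: filterS (@subset_closure _ C) _; exact: open_nbhs_nbhs.
(* Otherwise C lies on one side of g t, and its closure misses an end of g. *)
exfalso; have [l0 gA _] := giso.
have ll : 0 <= l <= l by lra.
have l00 : (0 : R) <= 0 <= l by lra.
have cC : connected C by rewrite CE; exact: component_connected.
have c1 : closed (g @` `[0, t]) by apply: (interval_isometry_closed giso); lra.
have c2 : closed (g @` `[t, l]) by apply: (interval_isometry_closed giso); lra.
have C12 y : C y -> (g @` `[0, t]) y \/ (g @` `[t, l]) y.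
  move=> /(@subset_closure _ C); rewrite -gA => -[s /= + <-]; rewrite in_itv/= => sl.
  by have [st|st] := lerP s t; [left|right]; exists s => //=; rewrite in_itv/=; lra.
have C12' y : C y -> (g @` `[0, t]) y -> ~ (g @` `[t, l]) y.
  move=> Cy [s /= + sE] [u /= + uE]; rewrite !in_itv/= => st ut.
  have su : s = u by apply: (interval_isometry_inj giso); [lra|lra|rewrite sE].
  by apply: nCg; rewrite (_ : t = s) ?sE//; lra.
have clS D : closed D -> C `<=` D -> closure C `<=` D.
  by move=> cD CD; rewrite [X in _ `<=` X](closure_id D).1//; exact: closure_subset.
have [C1|C1] := pselect (C `&` (g @` `[0, t]) !=set0).
  have CS : C `<=` g @` `[0, t].
    suff <- : C `&` (g @` `[0, t]) = C by move=> y [].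
    apply: cC => //; last by exists (g @` `[0, t]).
    exists (~` (g @` `[t, l])); first exact: closed_openC.
    apply/seteqP; split=> y [Cy H]; split=> //; first exact: C12'.
    by have [|/H] := C12 y Cy.
  have [s /= + sE] := clS _ c1 CS (g l) (interval_isometry_sub giso ll).
  rewrite in_itv/= => st; suff : s = l by lra.
  by apply: (interval_isometry_inj giso) => //; lra.
have CS : C `<=` g @` `[t, l].
  move=> y Cy; have [H|//] := C12 y Cy.
  by exfalso; apply: C1; exists y.
have [s /= + sE] := clS _ c2 CS (g 0) (interval_isometry_sub giso l00).
rewrite in_itv/= => st; suff : s = 0 by lra.
by apply: (interval_isometry_inj giso) => //; lra.
Qed.

End EdgeInterior.

(** * Neighborhoods of the edge: end charts and collar *)

Section Quotient.
Context {R : realType} {T : metricType R}.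
Implicit Types (x y : T).
Hypothesis net : @network R T.
Variable e : edge_segment T.

Let charts : @has_star_charts R T. Proof. by case: net. Qed.
Local Notation em := (edge_minus e).
Local Notation ep := (edge_plus e).
Local Notation proj := (collapse_map e).

(** Near [p] the edge is exactly branch [k0]. The last clause makes the parameter of any other
    branch its distance to the collapsed point. *)
Definition edge_end p (K : finType) r (phi : K -> R -> T) (k0 : K) :=
  [/\ star_chart p r phi,
      forall t, 0 <= t < r -> edge_set e (phi k0 t),
      forall k t, k != k0 -> 0 < t < r -> ~ edge_set e (phi k t) &
      forall k t, k != k0 -> 0 <= t < r -> dist_to_edge e (phi k t) = t].

Lemma edge_end_shrink p (K : finType) r (phi : K -> R -> T) (k0 : K) r' :
  0 < r' <= r -> edge_end p r phi k0 -> edge_end p r' phi k0.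
Proof.
move=> r'r [chart e0 e1 e2]; split; first exact: (chart_shrink chart r'r).
- by move=> t t0; apply: e0; lra.
- by move=> k t kk0 t0; apply: e1 => //; lra.
- by move=> k t kk0 t0; apply: e2 => //; lra.
Qed.

Lemma edge_end_exists l g : interval_isometry e l g ->
  exists (K : finType) r phi (k0 : K), edge_end (g 0) r phi k0.
Proof.
move=> giso; have [K [r [phi [k0 [chart ek0 ek]]]]] := interval_end_chart giso charts.
have [r0 phi0 cov dphi dphi'] := chart.
(* Halving the radius ensures that the points of [e] outside the original chart are farther away
   than the center. *)
have r2 : 0 < r / 2 <= r by lra.
have ep0 : edge_set e (g 0) by rewrite -(phi0 k0); apply: ek0; lra.
exists K, (r / 2), phi, k0; split; first exact: (chart_shrink chart r2).
- by move=> t t0; apply: ek0; lra.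
- by move=> k t kk0 t0; apply: ek => //; lra.
move=> k t kk0 t0; apply/eqP; rewrite eq_le; apply/andP; split.
  rewrite -[leRHS](chart_dist chart k (t := t)); last by lra.
  by rewrite metric_sym; exact: dist_to_edge_le.
apply: lb_le_inf; first by exists (mdist (phi k t) (g 0)), (g 0).
move=> _ [a ea <-]; have [ar|ar] := ltP (mdist (g 0) a) r; last first.
  have := metric_triangle (g 0) (phi k t) a; rewrite (chart_dist chart); lra.
have [->|[j [s [s0 aE]]]] := cov a ar.
  by rewrite metric_sym (chart_dist chart); lra.
have [jk|jk] := eqVneq j k0; last by exfalso; apply: (ek j s jk s0); rewrite -aE.
rewrite aE jk dphi'//; lra.
Qed.

Lemma edge_ends_neq : em <> ep.
Proof.
have [_ [_ [_ _ _ [l [g [giso <- <-]]]]]] := edge_setP e.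
have [l0 _ _] := giso; move/(interval_isometry_inj giso) => H.
by have := H ltac:(lra) ltac:(lra); lra.
Qed.

Lemma edge_plus_mem : edge_set e ep.
Proof.
have [_ [_ [_ _ _ [l [g [giso _ <-]]]]]] := edge_setP e.
have [l0 _ _] := giso; apply: (interval_isometry_sub giso); lra.
Qed.

Lemma edge_minus_mem : edge_set e em. Proof. exact: edge_nonempty. Qed.

(** With the factor 4, points at distances [s, t < r] from different ends are at distance at least
    [mdist em ep - s - t >= s + t], so the way through the collapsed edge is the shorter one. *)
Lemma edge_ends_exist : exists r (K1 K2 : finType) phi1 phi2 (k1 : K1) (k2 : K2),
  [/\ edge_end em r phi1 k1, edge_end ep r phi2 k2 & 4 * r <= mdist em ep].
Proof.
have [_ [_ [_ _ _ [l [g [giso gem gep]]]]]] := edge_setP e.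
have [K1 [r1 [phi1 [k1 e1]]]] := edge_end_exists giso.
have [K2 [r2 [phi2 [k2 e2]]]] := edge_end_exists (interval_isometry_rev giso).
rewrite subr0 gep in e2; rewrite gem in e1.
have d0 : 0 < mdist em ep by rewrite mdist_gt0; apply/eqP; exact: edge_ends_neq.
have [[r10 _ _ _ _] _ _ _] := e1; have [[r20 _ _ _ _] _ _ _] := e2.
pose r := Num.min (mdist em ep / 4) (Num.min r1 r2).
have r0 : 0 < r by rewrite !lt_min r10 r20 divr_gt0.
have rr1 : r <= r1 by rewrite /r !ge_min lexx !orbT.
have rr2 : r <= r2 by rewrite /r !ge_min lexx !orbT.
have rd : r <= mdist em ep / 4 by rewrite ge_min lexx.
exists r, K1, K2, phi1, phi2, k1, k2; split; last by lra.
- by apply: edge_end_shrink e1; rewrite r0.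
- by apply: edge_end_shrink e2; rewrite r0.
Qed.

Lemma edge_interior_nbhs x : edge_interior e x -> nbhs x (edge_set e).
Proof.
move=> [ex xends]; have [V [C [[finV _ _] compC eC [l [g [giso gem gep]]]]]] := edge_setP e.
have [_ gA _] := giso; rewrite -gA in ex; case: ex => t /= + gt.
rewrite in_itv/= => tl; rewrite -gt eC.
rewrite eC in giso; apply: (interval_interior_nbhs charts finV compC giso).
have t0 : t != 0 by apply/eqP => t0; apply: xends; left; rewrite -gem -gt t0.
have tnl : t != l by apply/eqP => tl'; apply: xends; right; rewrite -gep -gt tl'.
by rewrite !lt_neqAle eq_sym t0 tnl.
Qed.

Lemma dist_to_edge_gt0 x : ~ edge_set e x -> 0 < dist_to_edge e x.
Proof.
move=> nx; rewrite lt_def dist_to_edge_ge0 andbT.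
by apply/eqP => /dist_to_edge_eq0.
Qed.

(** One leaves the edge only through its ends. By compactness it suffices to argue locally: a point
    off [e] is at positive distance from it, and an interior point has a neighborhood inside [e]. *)
Lemma edge_collar r : 0 < r -> exists2 d, 0 < d & forall x, ~ edge_set e x ->
  dist_to_edge e x < d -> mdist em x < r \/ mdist ep x < r.
Proof.
move=> r0; have [_ cT _] := net.
have : \forall d \near 0^'+, [set: T] `<=` [set x | ~ edge_set e x ->
    dist_to_edge e x < d -> mdist em x < r \/ mdist ep x < r].
  apply: ((compact_near_coveringP [set: T]).1 cT _ 0^'+
    (fun d x => ~ edge_set e x ->
      dist_to_edge e x < d -> mdist em x < r \/ mdist ep x < r) _) => x _.
  have [ex|nx] := pselect (edge_set e x); last first.
    pose D := dist_to_edge e x; have D0 : 0 < D by exact: dist_to_edge_gt0.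
    exists (ball x (D / 2), [set d | d < D / 2]).
      split; first by apply: nbhsx_ballx; rewrite divr_gt0.
      by apply: nbhs_right_lt; rewrite divr_gt0.
    move=> [y d] /= [+ dD] _ yd; rewrite ballEmdist/= => xy.
    by have := dist_to_edge_triangle e x y; rewrite -/D; lra.
  have near_end p : x = p -> nbhs x [set y | mdist p y < r].
    by move=> ->; rewrite -ballEmdist; exact: nbhsx_ballx.
  have [xem|xem] := pselect (x = em).
    exists ([set y | mdist em y < r], setT); last by move=> [y d] /= [H _] _ _; left.
    by split; [exact: near_end|exact: filterT].
  have [xep|xep] := pselect (x = ep).
    exists ([set y | mdist ep y < r], setT); last by move=> [y d] /= [H _] _ _; right.
    by split; [exact: near_end|exact: filterT].
  exists (edge_set e, setT); last by move=> [y d] /= [].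
  split; last exact: filterT.
  by apply: edge_interior_nbhs; split=> // -[].
move=> H; have [d [d0 dP]] := @filter_ex _ (0^'+ : set_system R) _ _ (filterI H (nbhs_right_gt 0)).
by exists d => // x; exact: d0.
Qed.

End Quotient.

(** * Charts and functions on the collapsed graph *)

Section Descend.
Context {R : realType} {T : metricType R}.
Implicit Types (x y : T).
Hypothesis net : @network R T.
Variable e : edge_segment T.

Let charts : @has_star_charts R T. Proof. by case: net. Qed.
Local Notation em := (edge_minus e).
Local Notation ep := (edge_plus e).
Local Notation proj := (collapse_map e).
Local Notation Q := (collapse e).

Lemma projP (q : Q) : exists x, q = proj x.
Proof. by exists (repr q); rewrite /collapse_map reprK. Qed.

Lemma proj_eqP x y : proj x = proj y <-> x = y \/ edge_set e x /\ edge_set e y.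
Proof.
split=> [xy|H].
  have := quot_distE e x y; rewrite xy quot_distxx => /esym/collapse_dist_eq0.
  by move=> /orP[/eqP->|/andP[/asboolP ex /asboolP ey]]; [left|right].
apply/quot_dist_positivity; rewrite quot_distE.
have [->|[ex ey]] := H; first exact: collapse_distxx.
by rewrite (collapse_rel_dist y (x' := y)) ?collapse_distxx//; apply/orP; right;
  apply/andP; split; apply/asboolP.
Qed.

Lemma mdist_projE x y : mdist (proj x) (proj y) = collapse_dist e x y.
Proof. exact: quot_distE. Qed.

Lemma mdist_proj_edge x y : edge_set e x -> mdist (proj x) (proj y) = dist_to_edge e y.
Proof.
move=> ex; rewrite mdist_projE /collapse_dist (dist_to_edge_eq0 e x).2// add0r.
by apply/min_idPr; rewrite metric_sym dist_to_edge_le.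
Qed.

Lemma proj_continuous : continuous proj.
Proof.
move=> x B /nbhs_ballP[d /= d0 dB]; apply/nbhs_ballP; exists d => // y.
rewrite ballEmdist/= => xy; apply: dB; rewrite ballEmdist/= mdist_projE.
by rewrite /collapse_dist gt_min xy.
Qed.

(** Between two points closer to [x] than half the distance from [x] to [e], a detour through [e] is
    never shorter; the projection is thus isometric on the ball. *)
Lemma chart_proj (K : finType) x r (phi : K -> R -> T) : star_chart x r phi ->
  r <= dist_to_edge e x / 2 -> star_chart (proj x) r (fun k t => proj (phi k t)).
Proof.
move=> chart rD; have [r0 phi0 cov dphi dphi'] := chart.
have projd y z : mdist x y < r -> mdist x z < r -> mdist (proj y) (proj z) = mdist y z.
  move=> yr zr; rewrite mdist_projE; apply/min_idPl.
  have := metric_triangle y x z; rewrite (metric_sym y x).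
  by have := dist_to_edge_triangle e x y; have := dist_to_edge_triangle e x z; lra.
have phir k t : 0 <= t < r -> mdist x (phi k t) < r.
  by move=> t0; rewrite (chart_dist chart)//; lra.
split=> // [k|q qr|k s t s0 t0|j k s t jk s0 t0]; first by rewrite phi0.
- have [y yE] := projP q; move: qr; rewrite yE mdist_projE /collapse_dist gt_min.
  have := dist_to_edge_ge0 e y => Dy0 /orP[yr|H]; last by exfalso; lra.
  have [->|[k [t [t0 ->]]]] := cov y yr; [by left|right].
  by exists k, t.
- by rewrite projd ?phir// dphi.
- by rewrite projd ?phir// dphi'.
Qed.

(** The directions at the collapsed point: those of both ends except the two that enter the edge.
    There are none when the edge is the whole graph. *)
Definition end_index (K1 K2 : finType) (k1 : K1) (k2 : K2) :=
  ({k | k != k1} + {k | k != k2})%type.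

Definition end_branch (K1 K2 : finType) (phi1 : K1 -> R -> T) (phi2 : K2 -> R -> T)
    (k1 : K1) (k2 : K2) (k : end_index k1 k2) (t : R) : Q :=
  match k with inl k => proj (phi1 (val k) t) | inr k => proj (phi2 (val k) t) end.

(** In the quotient distance, a minimum, the direct term wins on a single branch because
    [|s - t| <= s + t], both terms agree on two branches of the same end, and the jump wins between
    different ends. The collar shows that no other point is close to the collapsed one. *)
Lemma edge_chart_proj (K1 K2 : finType) phi1 phi2 (k1 : K1) (k2 : K2) r r' :
  edge_end e em r phi1 k1 -> edge_end e ep r phi2 k2 -> 4 * r <= mdist em ep ->
  0 < r' <= r -> (forall x, ~ edge_set e x -> dist_to_edge e x < r' ->
                    mdist em x < r \/ mdist ep x < r) ->
  star_chart (proj em) r' (@end_branch _ _ phi1 phi2 k1 k2).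
Proof.
move=> [c1 in1 out1 d1] [c2 in2 out2 d2] rd r'r collar.
have [r0 phi10 cov1 dphi1 dphi1'] := c1; have [_ phi20 cov2 dphi2 dphi2'] := c2.
have Em : edge_set e em by exact: edge_minus_mem.
have Ep : edge_set e ep by exact: edge_plus_mem.
have lt t : 0 <= t < r' -> 0 <= t < r by move=> t0; lra.
have cross (k : {k | k != k1}) (j : {k | k != k2}) s t : 0 <= s < r' -> 0 <= t < r' ->
    mdist (proj (phi1 (val k) s)) (proj (phi2 (val j) t)) = s + t.
  move=> s0 t0; rewrite mdist_projE /collapse_dist d1 ?d2 ?(valP k) ?(valP j) ?lt//.
  apply/min_idPr; have := metric_triangle em (phi1 (val k) s) ep.
  have := metric_triangle (phi1 (val k) s) (phi2 (val j) t) ep.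
  rewrite (chart_dist c1) ?lt// (metric_sym (phi2 _ _)) (chart_dist c2) ?lt//; lra.
have same (K : finType) p (phi : K -> R -> T) k0 (k : {k | k != k0}) s t :
    edge_end e p r phi k0 -> 0 <= s < r' -> 0 <= t < r' ->
    mdist (proj (phi (val k) s)) (proj (phi (val k) t)) = `|s - t|.
  move=> [[_ _ _ dphi _] _ _ d] s0 t0; rewrite mdist_projE /collapse_dist !d ?(valP k) ?lt//.
  rewrite dphi ?lt//; apply/min_idPl; rewrite ler_norml; lra.
have other (K : finType) p (phi : K -> R -> T) k0 (k j : {k | k != k0}) s t :
    edge_end e p r phi k0 -> k != j -> 0 <= s < r' -> 0 <= t < r' ->
    mdist (proj (phi (val k) s)) (proj (phi (val j) t)) = s + t.
  move=> [[_ _ _ _ dphi] _ _ d] kj s0 t0.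
  rewrite mdist_projE /collapse_dist !d ?(valP k) ?(valP j) ?lt//.
  by rewrite dphi ?lt// minxx.
split=> //; first by lra.
- case=> k /=; first by rewrite phi10.
  by rewrite phi20; apply/proj_eqP; right.
- move=> q qr; have [x xE] := projP q; rewrite xE.
  have [ex|nx] := pselect (edge_set e x); first by left; apply/proj_eqP; right.
  move: qr; rewrite xE mdist_proj_edge// => xr'.
  have [xr|xr] := collar x nx xr'; right.
    have [xem|[k [t [t0 xphi]]]] := cov1 x xr; first by case: nx; rewrite xem.
    have kk1 : k != k1 by apply/eqP => kk1; apply: nx; rewrite xphi kk1; apply: in1; lra.
    exists (inl (Sub k kk1)), t => /=; split; last by rewrite xphi.
    by move: xr'; rewrite xphi d1//; lra.
  have [xem|[k [t [t0 xphi]]]] := cov2 x xr; first by case: nx; rewrite xem.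
  have kk2 : k != k2 by apply/eqP => kk2; apply: nx; rewrite xphi kk2; apply: in2; lra.
  exists (inr (Sub k kk2)), t => /=; split; last by rewrite xphi.
  by move: xr'; rewrite xphi d2//; lra.
- by move=> [k|k] s t s0 t0 /=; [apply: (same _ em)|apply: (same _ ep)].
- move=> [k|k] [j|j] s t kj s0 t0 /=.
  + exact: (other _ em).
  + exact: cross.
  + by rewrite metric_sym cross// addrC.
  + exact: (other _ ep).
Qed.

Lemma edge_chart_exists : exists (K1 K2 : finType) phi1 phi2 (k1 : K1) (k2 : K2) r,
  [/\ edge_end e em r phi1 k1, edge_end e ep r phi2 k2 &
      star_chart (proj em) r (@end_branch _ _ phi1 phi2 k1 k2)].
Proof.
have [r [K1 [K2 [phi1 [phi2 [k1 [k2 [e1 e2 rd]]]]]]]] := edge_ends_exist net e.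
have r0 : 0 < r by case: e1 => -[].
have [d d0 collar] := edge_collar net e r0.
have r'r : 0 < Num.min r d <= r by rewrite lt_min r0 d0 ge_min lexx.
exists K1, K2, phi1, phi2, k1, k2, (Num.min r d); split.
- exact: edge_end_shrink r'r e1.
- exact: edge_end_shrink r'r e2.
- apply: (edge_chart_proj e1 e2 rd r'r) => x nx.
  by rewrite lt_min => /andP[_]; exact: collar.
Qed.

Lemma network_collapse : @network R Q.
Proof.
have [_ cT conT] := net.
have projT : proj @` setT = setT.
  by apply/seteqP; split=> // q _; have [x ->] := projP q; exists x.
split.
- move=> q; have [x ->] := projP q.
  have [ex|nx] := pselect (edge_set e x).
    have [K1 [K2 [phi1 [phi2 [k1 [k2 [r [_ _ c]]]]]]]] := edge_chart_exists.
    have -> : proj x = proj em by apply/proj_eqP; right; split=> //; exact: edge_minus_mem.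
    by exists (end_index k1 k2), r, (@end_branch _ _ phi1 phi2 k1 k2).
  have [K [r [phi c]]] := charts x; have [r0 _ _ _ _] := c.
  have D0 := dist_to_edge_gt0 nx.
  pose r' := Num.min r (dist_to_edge e x / 2).
  exists K, r', (fun k t => proj (phi k t)); apply: chart_proj.
    by apply: (chart_shrink c); rewrite lt_min r0 divr_gt0// ge_min lexx.
  by rewrite ge_min lexx orbT.
- rewrite -projT; apply: continuous_compact => //; apply: continuous_subspaceT.
  exact: proj_continuous.
- rewrite -projT; apply: connected_continuous_connected => //.
  by apply: continuous_subspaceT; exact: proj_continuous.
Qed.

Section Function.
Variable F : T -> R.
Hypotheses (aF : germ_affine F) (Fe : forall x, edge_set e x -> F x = F em).

Definition descend (q : Q) : R := F (repr q).

Lemma descendE x : descend (proj x) = F x.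
Proof.
rewrite /descend.
have /proj_eqP[->//|[e1 e2]] : proj (repr (proj x)) = proj x by rewrite /collapse_map reprK.
by rewrite !Fe.
Qed.

(** On the branches [k1] and [k2] that run inside [e], [F] is constant and its slope is 0, so
    dropping them preserves the sums; the charges of the two ends add up. *)
Lemma descend_local x : exists (K : finType) r (phi : K -> R -> Q) (b : K -> R),
  [/\ star_chart (proj x) r phi,
    forall k t, 0 <= t < r -> descend (phi k t) = descend (proj x) + b k * t &
    - \sum_k b k = if `[< edge_set e x >] then sigma F em + sigma F ep else sigma F x].
Proof.
have [ex|nx] := pselect (edge_set e x); last first.
  have [K [r [phi c]]] := charts x.
  have [r1 r1r [b Fb]] := affine_chart c aF.
  have D0 := dist_to_edge_gt0 nx.
  pose r' := Num.min r1 (dist_to_edge e x / 2).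
  have r'r1 : 0 < r' <= r1 by rewrite lt_min divr_gt0// ge_min lexx; lra.
  exists K, r', (fun k t => proj (phi k t)), b; split.
  - apply: chart_proj; first by apply: (chart_shrink c); lra.
    by rewrite ge_min lexx orbT.
  - by move=> k t t0; rewrite !descendE Fb//; lra.
  - by rewrite asboolF// (chart_sigma c r1r Fb).
have [K1 [K2 [phi1 [phi2 [k1 [k2 [r [[c1 in1 _ _] [c2 in2 _ _] c]]]]]]]] := edge_chart_exists.
have [r1 r1r [b1 Fb1]] := affine_chart c1 aF.
have [r2 r2r [b2 Fb2]] := affine_chart c2 aF.
have r12 : 0 < Num.min r1 r2 <= r by rewrite lt_min ge_min; lra.
have [rr1 rr2] : Num.min r1 r2 <= r1 /\ Num.min r1 r2 <= r2 by rewrite !ge_min !lexx orbT.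
have Fep : F ep = F em by apply: Fe; exact: edge_plus_mem.
have xem : proj x = proj em by apply/proj_eqP; right; split=> //; exact: edge_minus_mem.
exists (end_index k1 k2), (Num.min r1 r2), (@end_branch _ _ phi1 phi2 k1 k2),
  (fun k => match k with inl k => b1 (val k) | inr k => b2 (val k) end); split.
- by rewrite xem; exact: (chart_shrink c).
- move=> [k|k] t t0; rewrite xem /= !descendE.
    by rewrite Fb1//; lra.
  by rewrite Fb2 ?Fep//; lra.
rewrite asboolT// (chart_sigma c1 r1r Fb1) (chart_sigma c2 r2r Fb2).
have zero (b s u : R) : 0 < s -> u = u + b * s -> b = 0.
  move=> s0 us; have : b * s == 0 by apply/eqP; lra.
  by rewrite mulf_eq0 (gt_eqF s0) orbF => /eqP.
have b10 : b1 k1 = 0.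
  apply: (zero _ (r1 / 2) (F em)); first by lra.
  by rewrite -Fb1 ?(Fe (in1 _ _))//; lra.
have b20 : b2 k2 = 0.
  apply: (zero _ (r2 / 2) (F em)); first by lra.
  by rewrite -{2}Fep -Fb2 ?(Fe (in2 _ _))//; lra.
rewrite big_sumType/= -opprD; congr (- (_ + _)).
  by rewrite [RHS](bigD1 k1)//= b10 add0r (big_sub [pred k | k != k1]).
by rewrite [RHS](bigD1 k2)//= b20 add0r (big_sub [pred k | k != k2]).
Qed.

Lemma descend_germ_affine : germ_affine descend.
Proof.
move=> q g gq; have [x xE] := projP q; rewrite xE in gq *.
have [K [r [phi [b [c Fb _]]]]] := descend_local x.
exact: (affine_chartI c Fb gq).
Qed.

Lemma sigma_descend x : sigma descend (proj x) =
  if `[< edge_set e x >] then sigma F em + sigma F ep else sigma F x.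
Proof.
have [K [r [phi [b [c Fb <-]]]]] := descend_local x.
by rewrite (chart_sigma c _ Fb)// lexx (chart_radius c).
Qed.

End Function.
End Descend.

(** * Resistances *)

Section Resistance.
Context {R : realType} {T : metricType R}.
Implicit Types (x y z : T) (f : T -> R).
Hypothesis net : @network R T.

Let charts : @has_star_charts R T. Proof. by case: net. Qed.
Let cT : compact [set: T]. Proof. by case: net. Qed.
Let conT : connected [set: T]. Proof. by case: net. Qed.

Lemma dirac_diff_le0 x y q : q != x -> dirac_diff x y q <= 0 :> R.
Proof. by move=> /negPf qx; rewrite /dirac_diff qx sub0r oppr_le0 ler0n. Qed.

(** The only positive charge of the potential is at [x], so its maximum is there. *)
Lemma jfun_le_resistance x y p : jfun y p x <= resistance x y :> R.
Proof.
apply: (max_principle charts cT conT (x := x) (jfun_affine net y x)) => q qx.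
by rewrite sigma_jfun// dirac_diff_le0.
Qed.

Lemma resistance_ge0 x y : 0 <= resistance x y :> R.
Proof. by rewrite -(jfun_base net y x) jfun_le_resistance. Qed.

Lemma germ_affineN f : germ_affine f -> germ_affine (fun x => - f x).
Proof.
move=> af; have := germ_affine_lin (-1) af (germ_affine_cst 0).
by congr germ_affine; apply/funext => x; rewrite mulN1r addr0.
Qed.

Lemma sigmaN f p : germ_affine f -> sigma (fun x => - f x) p = - sigma f p.
Proof.
move=> af; have := sigma_lin charts (-1) p af (germ_affine_cst 0).
rewrite sigma_cst// addr0 mulN1r => <-.
by congr (sigma _ p); apply/funext => x; rewrite mulN1r addr0.
Qed.

Lemma resistance_sym x y : resistance x y = resistance y x :> R.
Proof.
rewrite {2}/resistance (@jfunE _ _ net (fun p => - jfun y p x)).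
- by rewrite (jfun_base net) oppr0 sub0r opprK.
- exact/germ_affineN/jfun_affine.
- apply/funext => q; rewrite sigmaN; last exact: jfun_affine.
  by rewrite sigma_jfun// /dirac_diff opprB.
Qed.

(** The potential is largest at [x] and smallest at [y]; with equal values there it would be
    constant, which its unit charge at [x] forbids. *)
Lemma resistance_gt0 x y : x <> y -> 0 < resistance x y :> R.
Proof.
move=> xy; rewrite lt_def resistance_ge0 andbT; apply/eqP => r0.
have J0 p : jfun y p x = 0 :> R.
  apply/eqP; rewrite eq_le -{1}r0 jfun_le_resistance/=.
  rewrite -lerN2 -(jfun_base net y x).
  apply: (max_principle charts cT conT (f := fun p => - jfun y p x)).
    exact/germ_affineN/jfun_affine.
  move=> q qy; rewrite sigmaN; last exact: jfun_affine.
  by rewrite sigma_jfun// /dirac_diff (negPf qy) subr0 oppr_le0 ler0n.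
have := congr1 (fun h => h x) (sigma_jfun net y x).
rewrite (_ : (fun p => jfun y p x) = fun=> 0); last by apply/funext.
rewrite sigma_cst// /dirac_diff eqxx; move/eqP/negPf : xy => ->.
by rewrite subr0 => /esym/eqP; rewrite oner_eq0.
Qed.

(** The two potentials based at [q] differ by one with charges 1 at [z] and -1 at [w]: the charges
    at [q] cancel, and a potential is unique up to a constant. *)
Lemma cross_ratioE q x y z w :
  cross_ratio q x y z w = jfun w x z - jfun w y z :> R.
Proof.
pose f p : R := -1 * jfun q p w + jfun q p z.
have -> : jfun w x z - jfun w y z = f x - f y.
  apply/esym/(sigma_inj charts cT conT (g := fun p => jfun w p z)).
  - by apply: germ_affine_lin; exact: jfun_affine.
  - exact: jfun_affine.
  - apply/funext => p; rewrite sigma_lin//; [|exact: jfun_affine..].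
    by rewrite !sigma_jfun// /dirac_diff; ring.
by rewrite /cross_ratio /f; ring.
Qed.

End Resistance.

(** * The potential of the collapsed graph and the two claims *)

Section Collapsing.
Context {R : realType} {T : metricType R}.
Hypothesis net : @network R T.
Variable e : edge_segment T.

Let charts : @has_star_charts R T. Proof. by case: net. Qed.
Let cT : compact [set: T]. Proof. by case: net. Qed.
Let conT : connected [set: T]. Proof. by case: net. Qed.
Local Notation em := (edge_minus e).
Local Notation ep := (edge_plus e).
Local Notation proj := (collapse_map e).

(** If the maximum over [e] exceeded the value at the ends, it would be attained only in the
    interior, which is open in the graph; it would then spread to the whole graph and reach [em]. *)
Lemma edge_max (F : T -> R) : germ_affine F -> F em = F ep ->
  (forall p, edge_interior e p -> sigma F p <= 0) ->
  forall p, edge_set e p -> F p <= F em.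
Proof.
move=> aF Fends sF p ep'.
have ce : compact (edge_set e) by exact: subclosed_compact (@edge_closed _ _ e) cT _.
have [||p0 + pmax] := @compact_EVT_max _ _ F (edge_set e) _ ce.
- by exists p.
- by apply: continuous_subspaceT; exact: germ_affine_continuous.
rewrite inE => ep0; have {}pmax q : edge_set e q -> F q <= F p0.
  by move=> eq; apply: pmax; rewrite inE.
apply: le_trans (pmax _ ep') _; rewrite leNgt; apply/negP => Fp0.
have [q eq Fq|] := connected_const_max charts conT aF (@edge_closed _ _ e) ep0 pmax _ em.
  have intq : edge_interior e q.
    split=> // -[qE|qE]; first by move: Fp0; rewrite -Fq qE ltxx.
    by move: Fp0; rewrite -Fq qE Fends ltxx.
  split; last exact: sF.
  have /nbhs_ballP[d /= d0 dE] := edge_interior_nbhs net intq.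
  by exists d => // z qz; apply: dE; rewrite ballEmdist.
by move=> _ FE; move: Fp0; rewrite FE ltxx.
Qed.

Lemma edge_const (F : T -> R) : germ_affine F -> F em = F ep ->
  (forall p, edge_interior e p -> sigma F p = 0) ->
  forall p, edge_set e p -> F p = F em.
Proof.
move=> aF Fends sF p ep'; apply/eqP; rewrite eq_le; apply/andP; split.
  by apply: edge_max => // q /sF->.
rewrite -lerN2; apply: (@edge_max (fun x => - F x)) => //.
- exact: germ_affineN.
- by rewrite Fends.
- by move=> q iq; rewrite sigmaN// sF// oppr0.
Qed.

Section Potential.
Variables x y : T.
Hypotheses (xe : ~ edge_interior e x) (ye : ~ edge_interior e y).

(** In electrical terms, the current that a wire short-circuiting the two ends carries from [em] to
    [ep] when a unit current enters at [x] and leaves at [y]. *)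
Definition collapse_coef : R :=
  (jfun y em x - jfun y ep x) / resistance em ep.

Definition collapse_potential (p : T) : R :=
  - collapse_coef * jfun ep p em + jfun y p x.

Local Notation c := collapse_coef.
Local Notation F := collapse_potential.

Lemma collapse_potential_affine : germ_affine F.
Proof. by apply: germ_affine_lin; exact: jfun_affine. Qed.

Lemma sigma_collapse_potential p :
  sigma F p = dirac_diff x y p - c * dirac_diff em ep p.
Proof.
rewrite sigma_lin//; [|exact: jfun_affine..].
by rewrite !sigma_jfun//; ring.
Qed.

Lemma collapse_potential_const p : edge_set e p -> F p = F em.
Proof.
apply: edge_const; first exact: collapse_potential_affine.
  rewrite /F (jfun_base net) -/(resistance em ep) mulr0 add0r mulNr divfK ?subrr.
    by rewrite opprB subrK.
  by rewrite gt_eqF// resistance_gt0//; exact: edge_ends_neq.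
move=> q intq; rewrite sigma_collapse_potential /dirac_diff.
have ne z : ~ edge_interior e z -> (q == z) = false.
  by move=> nz; apply/eqP => qz; apply: nz; rewrite -qz.
have nem : ~ edge_interior e em by move=> [_]; apply; left.
have nep : ~ edge_interior e ep by move=> [_]; apply; right.
by rewrite !ne// subrr mulr0 subrr.
Qed.

Lemma proj_eqb p q : (proj p == proj q) =
  (p == q) || `[< edge_set e p >] && `[< edge_set e q >].
Proof.
apply/eqP/orP => [/proj_eqP[->|[pe qe]]|[/eqP->//|/andP[/asboolP pe /asboolP qe]]].
- by left.
- by right; apply/andP; split; apply/asboolP.
- by apply/proj_eqP; right.
Qed.

(** The two ends are distinct, so a charge placed at one of them is counted exactly once when the
    ends merge. *)
Lemma end_count z : ~ edge_interior e z ->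
  (em == z)%:R + (ep == z)%:R = `[< edge_set e z >]%:R :> R.
Proof.
move=> nz; have epm : (ep == em) = false by apply/eqP => /esym; exact: edge_ends_neq.
have [zm|zm] := eqVneq z em; first by rewrite zm epm addr0 asboolT//; exact: edge_minus_mem.
have [zp|zp] := eqVneq z ep; first by rewrite zp add0r asboolT//; exact: edge_plus_mem.
rewrite addr0 asboolF// => ze; apply: nz; split=> // -[] E; first by rewrite E eqxx in zm.
by rewrite E eqxx in zp.
Qed.

(** The correcting charges [- c] at [em] and [c] at [ep] cancel at the collapsed point. *)
Lemma sigma_descend_collapse_potential :
  sigma (descend F : collapse e -> R) = dirac_diff (proj x) (proj y).
Proof.
apply/funext => q; have [p ->] := projP q.
rewrite (sigma_descend net collapse_potential_affine collapse_potential_const).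
rewrite /dirac_diff !proj_eqb; case: asboolP => [pe|pe] /=; last first.
  rewrite !orbF sigma_collapse_potential /dirac_diff.
  have [pm|_] := eqVneq p em; first by case: pe; rewrite pm; exact: edge_minus_mem.
  have [pp|_] := eqVneq p ep; first by case: pe; rewrite pp; exact: edge_plus_mem.
  by rewrite subrr mulr0 subr0.
rewrite !sigma_collapse_potential /dirac_diff.
have orE z : (p == z) || `[< edge_set e z >] = `[< edge_set e z >].
  by have [<-|//] := eqVneq p z; rewrite asboolT.
have epm : (ep == em) = false by apply/eqP => /esym; exact: edge_ends_neq.
rewrite !orE -!end_count// !eqxx epm [em == ep]eq_sym epm; ring.
Qed.

Lemma jfun_collapse p : jfun (proj y) (proj p) (proj x) = F p - F y.
Proof.
rewrite (jfunE (network_collapse net e) (proj p)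
  (descend_germ_affine net collapse_potential_affine collapse_potential_const)
  sigma_descend_collapse_potential).
by rewrite !(descendE collapse_potential_const).
Qed.

Lemma resistance_collapse q : resistance (proj x) (proj y) =
  resistance x y - cross_ratio q x y em ep ^+ 2 / resistance em ep.
Proof.
rewrite {1}/resistance jfun_collapse /F /c (jfun_base net) (cross_ratioE net).
(* The numerator of the coefficient and the difference it multiplies are the same number by
   reciprocity, whence the square. *)
rewrite -(reciprocity net (jfun_affine net y x) (jfun_affine net ep em)
  (sigma_jfun net y x) (sigma_jfun net ep em)) /resistance; ring.
Qed.

End Potential.

(* The potential of the collapsed graph is maximal at e, so its pull-back has charges
   1 - c and c at the ends of e which are both nonnegative. *)
Lemma resistance_collapse_edge x y : edge_set e x -> ~ edge_set e y ->
  resistance (proj x) (proj y) <= resistance x y.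
Proof.
move=> ex ney.
have xem : proj x = proj em.
  by apply/proj_eqP; right; split=> //; exact: edge_minus_mem.
have nem : ~ edge_interior e em by move=> [_]; apply; left.
have ny : ~ edge_interior e y by move=> [].
(* [x] may lie in the interior of [e], but its image is that of [em], for which the potential is
   available. *)
rewrite xem /resistance jfun_collapse//.
set F := collapse_potential em y; set c := collapse_coef em y.
have Fc := collapse_potential_const nem ny; rewrite -/F in Fc.
have Fmax p : F p <= F em.
  have := jfun_le_resistance (network_collapse net e) (proj em) (proj y) (proj p).
  by rewrite /resistance !jfun_collapse// lerD2r.
have aF : germ_affine F by exact: collapse_potential_affine.
have [ym yp] : (em == y) = false /\ (ep == y) = false.
  by split; apply/eqP => yE; apply: ney; rewrite -yE; [exact: edge_minus_mem|exact: edge_plus_mem].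
have epm : (ep == em) = false by apply/eqP => /esym; exact: edge_ends_neq.
have : 0 <= sigma F em by apply: (sigma_max_ge0 charts aF ltr01) => p _; exact: Fmax.
have : 0 <= sigma F ep.
  apply: (sigma_max_ge0 charts aF ltr01) => p _.
  by rewrite (Fc ep)//; exact: edge_plus_mem.
rewrite !sigma_collapse_potential /dirac_diff -/c ym yp !eqxx epm [em == ep]eq_sym epm.
move=> c0 c1; rewrite -(Fc x)// /F /collapse_potential -/c.
have recJ := reciprocity net (jfun_affine net y x) (jfun_affine net y em)
  (sigma_jfun net y x) (sigma_jfun net y em).
have recG := reciprocity net (jfun_affine net y x) (jfun_affine net ep em)
  (sigma_jfun net y x) (sigma_jfun net ep em).
have Jm := jfun_le_resistance net x y em; have Jp := jfun_le_resistance net x y ep.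
rewrite /resistance in Jm Jp; have J0 := jfun_base net y x.
rewrite /= in recJ recG.
(* Reciprocity exhibits the resistance as a combination, with weights [1 - c] and [c], of two values
   of the potential of [x], each at most [resistance x y]. *)
have -> : - c * jfun ep x em + jfun y x em - (- c * jfun ep y em + jfun y y em)
    = (1 - c) * jfun y em x + c * jfun y ep x - jfun y y x.
  rewrite (_ : jfun y x em = jfun y em x - jfun y y x + jfun y y em); last by lra.
  rewrite (_ : jfun ep x em = jfun y em x - jfun y ep x + jfun ep y em); last by lra.
  ring.
have {}c0 : 0 <= c by move: c0; rewrite subrr !sub0r mulrN1 opprK.
have {}c1 : 0 <= 1 - c by move: c1; rewrite !subr0 mulr1.
have := ler_wpM2l c0 Jp; have := ler_wpM2l c1 Jm.
by rewrite J0; lra.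
Qed.

End Collapsing.

Theorem corollaryB (R : realType) (Gamma : metricType R)
    (Gamma_graph : metric_graph Gamma) (e : edge_segment Gamma)
    (x y : Gamma) :
  (~ edge_interior e x -> ~ edge_interior e y ->
   forall q : Gamma,
   resistance (collapse_map e x) (collapse_map e y) =
   resistance x y - cross_ratio q x y (edge_minus e) (edge_plus e) ^+ 2
                    / resistance (edge_minus e) (edge_plus e)) /\
  resistance (collapse_map e x) (collapse_map e y) <= resistance x y.
Proof.
have net := metric_graph_network Gamma_graph.
split=> [xe ye q|]; first exact: resistance_collapse.
(* With both points in [e] the resistance vanishes; with one, convexity applies, up to symmetry;
   with none, the formula subtracts a nonnegative term. *)
have [ex|nex] := pselect (edge_set e x); have [ey|ney] := pselect (edge_set e y).
- have -> : collapse_map e x = collapse_map e y by apply/proj_eqP; right.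
  rewrite {1}/resistance (jfun_base (network_collapse net e)).
  exact: resistance_ge0.
- exact: resistance_collapse_edge.
- rewrite (resistance_sym net) (resistance_sym (network_collapse net e)).
  exact: resistance_collapse_edge.
- rewrite (resistance_collapse net (x := x) (y := y) _ _ x); [|by case..].
  rewrite gerBl divr_ge0 ?sqr_ge0//; exact: resistance_ge0.
Qed.
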